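(* Let $\Omega\subset\mathbb{R}^d$ be a bounded domain, let $f^+,f^-$ be finite positive Borel measures on $\Omega$ (not necessarily of equal mass), and let $g_1,g_2\in C(\partial\Omega)$ satisfy $$g_1(x)-g_2(y)\le |x-y|\qquad\text{for all }x,y\in\partial\Omega. \quad ( * )$$ Then $$\min\left\{\int_{\bar\Omega\times\bar\Omega}|x-y|\,d\gamma+\int_{\partial\Omega}g_2\,d(\Pi_y)_\#\gamma-\int_{\partial\Omega}g_1\,d(\Pi_x)_\#\gamma\ :\ \gamma\in\Pi b(f^+,f^-)\right\}$$ $$=\ \sup\left\{\int_\Omega\varphi\,d(f^+-f^-)\ :\ \varphi\in \mathrm{Lip}_1,\ g_1\le\varphi\le g_2\ \text{on }\partial\Omega\right\}.$$ Moreover, if $( * )$ is not satisfied (with $g_1,g_2\in C(\partial\Omega)$), then both sides of this equality (the left side read as an infimum) are $-\infty$.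
   Context: $\Pi_x,\Pi_y:\bar\Omega\times\bar\Omega\to\bar\Omega$ are the projections onto the first and second factor, $\#$ denotes push-forward, and $\mathcal{M}^+(X)$ is the set of finite positive Borel measures on $X$. The set of admissible plans is $$\Pi b(f^+,f^-)=\{\gamma\in\mathcal{M}^+(\bar\Omega\times\bar\Omega): \big((\Pi_x)_\#\gamma\big)\llcorner\Omega=f^+,\ \big((\Pi_y)_\#\gamma\big)\llcorner\Omega=f^-\},$$ where $\llcorner\Omega$ denotes restriction to the (open) set $\Omega$; thus the marginals are unconstrained on $\partial\Omega$. $\mathrm{Lip}_1$ is the set of functions on $\bar\Omega$ that are $1$-Lipschitz with respect to the Euclidean distance. The supremum of the empty set is $-\infty$. *)

(* Defs.v *)
From HB Require Import structures.
From mathcomp Require Import all_boot all_order all_algebra.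
From mathcomp Require Import all_classical all_reals all_analysis.

Set Implicit Arguments.
Unset Strict Implicit.
Unset Printing Implicit Defensive.

Import Order.TTheory GRing.Theory Num.Theory.
Import numFieldNormedType.Exports.

Local Open Scope classical_set_scope.
Local Open Scope ring_scope.

Notation borel T := (g_sigma_algebraType (@open T)).

(* The library norm on 'rV[R]_d is the sup norm; it induces the same topology
   and the same bounded sets as this Euclidean distance, but not the same
   1-Lipschitz functions or transport cost. *)
Definition eucl_dist (R : realType) (d : nat) (x y : 'rV[R]_d) : R :=
  Num.sqrt (\sum_(i < d) (x ord0 i - y ord0 i) ^+ 2).

Definition bounded_domain (R : realType) (d : nat) (Omega : set 'rV[R]_d) :
    Prop :=
  [/\ open Omega, connected Omega, Omega !=set0 & bounded_set Omega].

Definition boundary (T : topologicalType) (A : set T) : set T :=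
  closure A `\` A°.

(* A measure on a Borel set A is encoded as a measure on the whole space that
   vanishes outside A. *)
Definition concentrated_on (R : realType) (T : Type) (mu : set T -> \bar R)
    (A : set T) : Prop :=
  mu (~` A) = 0%E.

Definition Lip1 (R : realType) (d : nat) (A : set 'rV[R]_d)
    (phi : 'rV[R]_d -> R) : Prop :=
  {in A &, forall x y, `|phi x - phi y| <= eucl_dist x y}.

Section transport.
Variables (R : realType) (d : nat).
Local Notation E := 'rV[R]_d.
Variable Omega : set E.

Definition marginal1 (gamma : set (borel (E * E)%type) -> \bar R) :
    set (borel E) -> \bar R :=
  pushforward gamma (fst : borel (E * E)%type -> borel E).

Definition marginal2 (gamma : set (borel (E * E)%type) -> \bar R) :
    set (borel E) -> \bar R :=
  pushforward gamma (snd : borel (E * E)%type -> borel E).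

(* Set functions are total, so measures are compared on measurable sets only. *)
Definition restriction_eq (mu nu : set (borel E) -> \bar R) : Prop :=
  forall A : set (borel E), measurable A -> mu (A `&` Omega) = nu A.

Definition Pib (fp fm : {finite_measure set (borel E) -> \bar R}) :
    set {finite_measure set (borel (E * E)%type) -> \bar R} :=
  [set gamma | [/\ concentrated_on gamma (closure Omega `*` closure Omega),
    restriction_eq (marginal1 gamma) fp &
    restriction_eq (marginal2 gamma) fm]].

(* All the integrals in primal_cost and dual_value are finite when the data are
   admissible, so no indeterminate extended-real sum occurs. *)
Definition primal_cost (g1 g2 : E -> R)
    (gamma : {finite_measure set (borel (E * E)%type) -> \bar R}) : \bar R :=
  (\int[gamma]_(z in closure Omega `*` closure Omega) (eucl_dist z.1 z.2)%:E
   + \int[marginal2 gamma]_(y in boundary Omega) (g2 y)%:E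
   - \int[marginal1 gamma]_(x in boundary Omega) (g1 x)%:E)%E.

Definition dual_value (fp fm : {finite_measure set (borel E) -> \bar R})
    (phi : E -> R) : \bar R :=
  (\int[fp]_(x in Omega) (phi x)%:E - \int[fm]_(x in Omega) (phi x)%:E)%E.

Definition dual_admissible (g1 g2 : E -> R) : set (E -> R) :=
  [set phi | Lip1 (closure Omega) phi /\
    forall x, boundary Omega x -> g1 x <= phi x <= g2 x].

Definition boundary_compatible (g1 g2 : E -> R) : Prop :=
  forall x y, boundary Omega x -> boundary Omega y -> g1 x - g2 y <= eucl_dist x y.

Definition primal_inf (fp fm : {finite_measure set (borel E) -> \bar R})
    (g1 g2 : E -> R) : \bar R :=
  ereal_inf [set primal_cost g1 g2 gamma | gamma in Pib fp fm].

Definition dual_sup (fp fm : {finite_measure set (borel E) -> \bar R})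
    (g1 g2 : E -> R) : \bar R :=
  ereal_sup [set dual_value fp fm phi | phi in dual_admissible g1 g2].

End transport.

(* Main.v *)
(* Extend g1, g2 to continuous functions G1, G2. By the marginal constraints, the
   cost of an admissible plan gamma is, up to a constant, the integral of
   c(x, y) = |x - y| + G2 y - G1 x, and integrating phi x - phi y <= |x - y|
   against gamma gives weak duality.

   Under the compatibility condition c is nonnegative on pairs of boundary points,
   so only plans of mass at most m = fp(Omega) + fm(Omega) matter. This suggests
   the sublinear functional p on continuous functions h of (x, y) whose value is
   the infimum of
     int u dfp + int v dfm + s m + t D
   over the s, t >= 0 and the u, v vanishing on the boundary such that
   h <= u x + v y + s + t c, where D is the (shifted) supremum of the dual problem.
   It does not take the value -oo because an error s in the dual constraint can be
   repaired by an inf-convolution at the price s m. A linear functional below p is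
   positive, has the prescribed marginals and is at most D at c; by the Riesz
   representation theorem it is the integral against an admissible plan, which is
   therefore optimal.

   If the condition fails at (x, y), adding large multiples of the Dirac mass at
   (x, y) to an admissible plan sends its cost to -oo, and no function is
   admissible for the dual problem. *)

Require Import Defs.
From HB Require Import structures.
From mathcomp Require Import all_boot all_order all_algebra.
From mathcomp Require Import all_classical all_reals all_analysis.
From mathcomp Require Import finmap measurable_realfun ring lra.
Set Implicit Arguments.
Unset Strict Implicit.
Unset Printing Implicit Defensive.
Import Order.TTheory GRing.Theory Num.Theory.
Import numFieldNormedType.Exports.
Local Open Scope classical_set_scope.
Local Open Scope ring_scope.

(** * A linear functional below a sublinear one *)

Section hahn_banach.
Variables (R : realType) (V : lmodType R) (S : set V).
Hypothesis S_add : forall x y, S x -> S y -> S (x + y).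
Hypothesis S_scale : forall (a : R) x, S x -> S (a *: x).

(** [S] stands for a subspace; it will be the continuous functions among all functions. An
    inequality suffices for homogeneity: for [a > 0] the converse follows by applying it to the
    inverse of [a]. *)
Definition sublinear_on (q : V -> R) : Prop :=
  (forall x y, S x -> S y -> q (x + y) <= q x + q y) /\
  (forall (a : R) x, 0 <= a -> S x -> q (a *: x) <= a * q x).

Lemma sublinear_on_opp (q : V -> R) (x : V) :
  sublinear_on q -> S x -> - q (- x) <= q x.
Proof.
move=> [qD qZ] Sx.
have SNx : S (- x) by rewrite -scaleN1r; exact: S_scale.
have S0 : S 0 by rewrite -(scale0r x); exact: S_scale.
have := qD 0 0 S0 S0; have := qD _ _ Sx SNx.
rewrite subrr addr0; lra.
Qed.

Let inf_le_sub (A : set R) (c a : R) : (forall y, A y -> c <= y) -> A a -> inf A <= a.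
Proof. by move=> Ac Aa; apply: ge_inf => //; exists c => y /Ac. Qed.

Let le_inf_sub (A : set R) (c a : R) : A a -> (forall y, A y -> c <= y) -> c <= inf A.
Proof. by move=> Aa Ac; apply: lb_le_inf; [exists a|move=> y /Ac]. Qed.

(** For subadditivity, two members [q], [r] almost optimal at [x] and at [y] are comparable on [S],
    and the smaller one is almost optimal at both points. The minorant [c] keeps the real infima
    meaningful. *)
Lemma chain_inf_sublinear (F : set (V -> R)) (c : V -> R) (q0 : V -> R) :
  F q0 -> (forall q, F q -> sublinear_on q) ->
  (forall q x, F q -> S x -> c x <= q x) ->
  (forall q r, F q -> F r ->
    (forall x, S x -> q x <= r x) \/ (forall x, S x -> r x <= q x)) ->
  sublinear_on (fun x => inf [set q x | q in F]).
Proof.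
move=> Fq0 Fsub Fc Ftot.
have infle q x : F q -> S x -> inf [set q x | q in F] <= q x.
  move=> Fq Sx; apply: (@inf_le_sub _ (c x)); last by exists q.
  by move=> _ [r Fr <-]; exact: Fc.
split=> [x y Sx Sy|a x a0 Sx].
  rewrite -lerBlDr; apply: (@le_inf_sub _ _ (q0 x)); first by exists q0.
  move=> _ [q Fq <-]; rewrite lerBlDr -lerBlDl.
  apply: (@le_inf_sub _ _ (q0 y)); first by exists q0.
  move=> _ [r Fr <-]; rewrite lerBlDl.
  have Sxy := S_add Sx Sy.
  have [qr|rq] := Ftot q r Fq Fr.
    apply: (le_trans (infle _ _ Fq Sxy)).
    by apply: (le_trans ((Fsub _ Fq).1 _ _ Sx Sy)); rewrite lerD2l; exact: qr.
  apply: (le_trans (infle _ _ Fr Sxy)).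
  by apply: (le_trans ((Fsub _ Fr).1 _ _ Sx Sy)); rewrite lerD2r; exact: rq.
have Sax := S_scale a Sx.
move: a0; rewrite le_eqVlt => /predU1P[a0|a0].
  have := (Fsub _ Fq0).2 0 x (lexx _) Sx; rewrite mul0r => h.
  move: Sax; rewrite -a0 mul0r => S0x; exact: (le_trans (infle _ _ Fq0 S0x) h).
rewrite mulrC -ler_pdivrMr//; apply: (@le_inf_sub _ _ (q0 x)); first by exists q0.
move=> _ [q Fq <-]; rewrite ler_pdivrMr// mulrC.
by apply: (le_trans (infle _ _ Fq Sax)); apply: (Fsub _ Fq).2 => //; exact: ltW.
Qed.

(* Compare [q] with the sublinear functional
   [x |-> inf_(t >= 0) (q (x + t y) - t q y)], which lies below [q]. *)
Lemma minimal_sublinear_additive (q : V -> R) : sublinear_on q ->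
  (forall r, sublinear_on r -> (forall x, S x -> r x <= q x) ->
     forall x, S x -> q x <= r x) ->
  forall x y, S x -> S y -> q (x + y) = q x + q y.
Proof.
move=> qsub qmin x y Sx Sy; apply/eqP; rewrite eq_le (qsub.1 _ _ Sx Sy)/=.
pose B x := [set q (x + t *: y) - t * q y | t in [set t : R | 0 <= t]].
(* Subadditivity gives [q (t *: y) <= q (z + t *: y) + q (- z)], and positive homogeneity replaces
   the left side by [t * q y]. *)
have Blb z b : S z -> B z b -> - q (- z) <= b.
  move=> Sz [t /= t0 <-].
  have SNz : S (- z) by rewrite -scaleN1r; exact: S_scale.
  have Sty := S_scale t Sy.
  have := qsub.1 _ _ (S_add Sz Sty) SNz.
  rewrite addrAC subrr add0r => h.
  have hN : - q (- (t *: y)) <= q (t *: y) by exact: sublinear_on_opp.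
  have SNty : S (- (t *: y)) by rewrite -scaleN1r; exact: S_scale.
  have := qsub.2 t (- y) t0; rewrite scalerN -{1}scaleN1r => /(_ (S_scale _ Sy)).
  have Syy := qsub.1 y (- y) Sy.
  have ht := qsub.2 t _ t0 Sy.
  have [t00|tn0] := eqVneq t 0.
    move: h; rewrite t00 scale0r mul0r addr0.
    have S0 : S 0 by rewrite -(scale0r z); exact: S_scale.
    have := qsub.1 0 0 S0 S0; rewrite addr0; lra.
  have tp : 0 < t by rewrite lt_neqAle eq_sym tn0.
  have := qsub.2 t^-1 (t *: y); rewrite invr_ge0 => /(_ t0 Sty).
  rewrite scalerA mulVf// scale1r mulrC ler_pdivlMr// => h2 _.
  lra.
have leB z t : S z -> 0 <= t -> inf (B z) <= q (z + t *: y) - t * q y.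
  move=> Sz t0; apply: (@inf_le_sub _ (- q (- z))); last by exists t.
  by move=> b; exact: Blb.
have Bne z : B z (q (z + 0 *: y) - 0 * q y) by exists 0 => /=.
have rsub : sublinear_on (fun z => inf (B z)).
  split=> [z w Sz Sw|a z a0 Sz].
    rewrite -lerBlDr; apply: (@le_inf_sub _ _ _ (Bne z)) => _ [t /= t0 <-].
    rewrite lerBlDr -lerBlDl; apply: (@le_inf_sub _ _ _ (Bne w)) => _ [s /= s0 <-].
    rewrite lerBlDl (le_trans (leB _ (t + s) (S_add Sz Sw) (addr_ge0 t0 s0)))//.
    have := qsub.1 _ _ (S_add Sz (S_scale t Sy)) (S_add Sw (S_scale s Sy)).
    rewrite scalerDl addrACA; lra.
  have Saz := S_scale a Sz.
  move: a0; rewrite le_eqVlt => /predU1P[a0|a0].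
    rewrite -a0 scale0r mul0r.
    have S0 : S 0 by rewrite -(scale0r z); exact: S_scale.
    apply: (le_trans (leB _ 0 S0 (lexx _))).
    have := qsub.2 0 _ (lexx _) Sz; rewrite !scale0r !mul0r addr0; lra.
  rewrite mulrC -ler_pdivrMr//; apply: (@le_inf_sub _ _ _ (Bne z)) => _ [t /= t0 <-].
  rewrite ler_pdivrMr// (le_trans (leB _ (a * t) Saz (mulr_ge0 (ltW a0) t0)))//.
  rewrite -scalerA -scalerDr.
  have := qsub.2 a _ (ltW a0) (S_add Sz (S_scale t Sy)).
  lra.
have rq z : S z -> inf (B z) <= q z.
  move=> Sz; apply: (le_trans (leB _ 0 Sz (lexx _))).
  by rewrite scale0r addr0 mul0r subr0.
(* By minimality [q x] is at most the infimum over [t]; its value at [t = 1] yields the missing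
   superadditivity. *)
have := qmin _ rsub rq _ Sx => h.
by have := le_trans h (leB x 1 Sx ler01); rewrite scale1r mul1r lerBrDr.
Qed.

(** Zorn's lemma, for the reversed pointwise order on [S], gives a minimal sublinear functional
    below [p]. Minimality makes it additive, hence odd, and positive homogeneity then extends to all
    scalars. The order is only a preorder, since values outside [S] are ignored. *)
Lemma linear_below_sublinear (p : V -> R) : sublinear_on p ->
  exists f : V -> R, [/\ forall x, S x -> f x <= p x,
    forall x y, S x -> S y -> f (x + y) = f x + f y &
    forall (a : R) x, S x -> f (a *: x) = a * f x].
Proof.
move=> psub.
pose Q := {q : V -> R | sublinear_on q /\ forall x, S x -> q x <= p x}.
pose le (q r : Q) := `[< forall x, S x -> sval r x <= sval q x >].
have p0 : Q by exists p.
(* This minorant is common to all candidates, so the infimum of any chain is finite on [S]. *)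
have Qlb (q : Q) x : S x -> - p (- x) <= sval q x.
  move=> Sx; case: q => q [qsub qp] /=; apply: (le_trans _ (sublinear_on_opp qsub Sx)).
  by rewrite lerN2; apply: qp; rewrite -scaleN1r; exact: S_scale.
have [||A Atot|q qmax] := @ZL_preorder Q p0 le.
- by move=> t; apply/asboolP.
- move=> r s t /asboolP rs /asboolP st; apply/asboolP => x Sx.
  exact: le_trans (st _ Sx) (rs _ Sx).
- have [->|/set0P[q0 Aq0]] := eqVneq A set0; first by exists p0.
  pose F := [set sval q | q in A].
  pose m x := inf [set q x | q in F].
  have rsub : sublinear_on m.
    apply: (@chain_inf_sublinear F (fun x => - p (- x)) (sval q0)).
    + by exists q0.
    + by move=> _ [q Aq <-]; exact: (svalP q).1.
    + by move=> _ x [q Aq <-]; exact: Qlb.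
    + move=> _ _ [q Aq <-] [r Ar <-].
      by case: (Atot _ _ Aq Ar) => /asboolP; [right|left].
  have rle (q : Q) x : A q -> S x -> m x <= sval q x.
    move=> Aq Sx; apply: (@inf_le_sub _ (- p (- x))).
      by move=> _ [_ [s As <-] <-]; exact: Qlb.
    by exists (sval q) => //; exists q.
  have rp x : S x -> m x <= p x.
    by move=> Sx; apply: (le_trans (rle q0 x Aq0 Sx)); exact: (svalP q0).2.
  exists (exist _ m (conj rsub rp)) => s As; apply/asboolP => x Sx /=.
  exact: rle.
- have qsub := (svalP q).1.
  have qmin r : sublinear_on r -> (forall x, S x -> r x <= sval q x) ->
      forall x, S x -> sval q x <= r x.
    move=> rsub rq.
    have rp x : S x -> r x <= p x.
      by move=> Sx; apply: le_trans (rq _ Sx) _; exact: (svalP q).2.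
    have /asboolP := qmax (exist _ r (conj rsub rp)) (asboolT rq).
    by apply.
  have qD := minimal_sublinear_additive qsub qmin.
  exists (sval q); split=> //; first exact: (svalP q).2.
  have qN x : S x -> sval q (- x) = - sval q x.
    move=> Sx.
    have SNx : S (- x) by rewrite -scaleN1r; exact: S_scale.
    have S0 : S 0 by rewrite -(scale0r x); exact: S_scale.
    have := qD _ _ S0 S0; have := qD _ _ Sx SNx; rewrite subrr addr0; lra.
  have qZ a x : 0 <= a -> S x -> sval q (a *: x) = a * sval q x.
    move=> a0 Sx; apply/eqP; rewrite eq_le qsub.2//=.
    have := qsub.2 a (- x) a0; rewrite -{1}scaleN1r => /(_ (S_scale _ Sx)).
    rewrite scalerN !qN//; last exact: S_scale.
    by rewrite mulrN lerN2.
  move=> a x Sx; have [a0|a0] := leP 0 a; first exact: qZ.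
  have := qZ (- a) x; rewrite scaleNr qN; last exact: S_scale.
  rewrite oppr_ge0 => /(_ (ltW a0) Sx); lra.
Qed.

End hahn_banach.

(** * The Riesz representation theorem on a compact set *)

HB.instance Definition _ (T U : ptopologicalType) := Pointed.on (T * U)%type.

Section continuous_real.
Variables (R : realType) (T : topologicalType).

Lemma cont_add (f g : T -> R) : continuous f -> continuous g ->
  continuous (fun x => f x + g x).
Proof. by move=> cf cg x; apply: cvgD; [exact: cf|exact: cg]. Qed.

Lemma cont_mul (f g : T -> R) : continuous f -> continuous g ->
  continuous (fun x => f x * g x).
Proof. by move=> cf cg x; apply: cvgM; [exact: cf|exact: cg]. Qed.

Lemma cont_cst (a : R) : continuous (fun _ : T => a).
Proof. by move=> x; exact: cvg_cst. Qed.

Lemma cont_sub (f g : T -> R) : continuous f -> continuous g ->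
  continuous (fun x => f x - g x).
Proof. by move=> cf cg x; apply: cvgB; [exact: cf|exact: cg]. Qed.

Lemma cont_min (f g : T -> R) : continuous f -> continuous g ->
  continuous (fun x => Num.min (f x) (g x)).
Proof. by move=> cf cg x; apply: continuous_min; [exact: cf|exact: cg]. Qed.

Lemma cont_max (f g : T -> R) : continuous f -> continuous g ->
  continuous (fun x => Num.max (f x) (g x)).
Proof. by move=> cf cg x; apply: continuous_max; [exact: cf|exact: cg]. Qed.

Lemma continuous_compact_bound (A : set T) (f : T -> R) : compact A ->
  {within A, continuous f} -> exists M, forall x, A x -> `|f x| <= M.
Proof.
move=> cA cf; have /compact_bounded[M [_ MP]] : compact (f @` A).
  exact: continuous_compact.
by exists (M + 1) => x Ax; apply: (MP (M + 1)); [rewrite ltrDl|exists x].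
Qed.

End continuous_real.

(** * Borel measurability and integrability of continuous functions *)

Section borel.
Variables (R : realType) (T : ptopologicalType).

Lemma open_borel (U : set T) : open U -> measurable (U : set (borel T)).
Proof. exact: sub_sigma_algebra. Qed.

Lemma closed_borel (A : set T) : closed A -> measurable (A : set (borel T)).
Proof. by move/closed_openC/open_borel/measurableC; rewrite setCK. Qed.

Lemma continuous_borel (U : ptopologicalType) (f : T -> U) :
  continuous f -> measurable_fun setT (f : borel T -> borel U).
Proof.
move=> /continuousP cf.
apply: (@measurability _ _ (borel T) (borel U) setT f (@open U)) => //.
by move=> _ [A oA <-]; rewrite setTI; apply: open_borel; exact: cf.
Qed.

Lemma continuous_borel_real (f : T -> R) :
  continuous f -> measurable_fun setT (f : borel T -> R).
Proof.
move=> /continuousP cf; apply: (measurability _ (RGenOpens.measurableE R)).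
move=> _ [_ [a [b ->] <-]]; rewrite setTI; apply: open_borel.
exact/cf/interval_open.
Qed.

Lemma bounded_continuous_integrable
    (mu : {finite_measure set (borel T) -> \bar R}) (D : set (borel T))
    (f : T -> R) (M : R) : measurable D -> continuous f ->
  (forall x, D x -> `|f x| <= M) -> mu.-integrable D (EFin \o f).
Proof.
move=> mD cf fM; apply: measurable_bounded_integrable => //.
- by rewrite -ge0_fin_numE//; exact: fin_num_measure.
- by apply: measurable_funTS; exact: continuous_borel_real.
- exists M; split; first exact: num_real.
  move=> y My x Dx; apply: (le_trans (fM _ Dx)); exact: ltW.
Qed.

End borel.

Section double_series.
Local Open Scope ereal_scope.

(** The enumeration [e] is chosen before the family [a], so that one reindexing serves both the
    values of a functional and the pointwise values of a double family of functions. *)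
Lemma nneseries_nat_pair (R : realType) :
  exists e : nat -> nat * nat, forall a : nat -> nat -> \bar R,
    (forall i j, 0 <= a i j) ->
    \sum_(k <oo) a (e k).1 (e k).2 = \sum_(i <oo) \sum_(j <oo) a i j.
Proof.
have /card_esym/ppcard_eqP[e] := card_nat2.
exists e => a a0.
rewrite nneseries_esumT; last by move=> n; exact: a0.
rewrite nneseries_esumT; last by move=> n; exact: nneseries_ge0.
under [RHS]eq_esum => i _ do rewrite nneseries_esumT//.
rewrite esum_esum//.
rewrite -(@reindex_esum _ _ _ setT setT e (fun k => a k.1 k.2))//.
by congr esum; apply/seteqP; split.
Qed.

End double_series.

(** * Daniell's construction of a measure from a positive linear functional *)

Section daniell.
Variables (R : realType) (T : ptopologicalType) (K : set T).
Variable L : (T -> R) -> R.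
Hypothesis compactK : compact K.
Hypothesis closedK : closed K.
Hypothesis open_cozero : forall U : set T, open U ->
  exists phi : T -> R, [/\ continuous phi, forall x, 0 <= phi x &
    U = [set x | 0 < phi x]].
Hypothesis LD : forall f g : T -> R, continuous f -> continuous g ->
  L (fun x => f x + g x) = L f + L g.
Hypothesis LZ : forall (a : R) (f : T -> R), continuous f ->
  L (fun x => a * f x) = a * L f.
Hypothesis L_ge0 : forall f : T -> R, continuous f -> (forall x, K x -> 0 <= f x) ->
  0 <= L f.

Let LB (f g : T -> R) : continuous f -> continuous g ->
  L (fun x => f x - g x) = L f - L g.
Proof.
move=> cf cg.
have -> : (fun x => f x - g x) = (fun x => f x + -1 * g x).
  by apply/funext => x; rewrite mulN1r.
by rewrite LD// ?LZ// ?mulN1r// => x; apply: cont_mul => // y; exact: cont_cst.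
Qed.

Let L_le (f g : T -> R) : continuous f -> continuous g ->
  (forall x, K x -> f x <= g x) -> L f <= L g.
Proof.
move=> cf cg fg; rewrite -subr_ge0 -LB//; apply: L_ge0; first exact: cont_sub.
by move=> x Kx; rewrite subr_ge0 fg.
Qed.

Let L0 : L (fun=> 0) = 0.
Proof.
have -> : (fun=> 0) = (fun x : T => 0 * (0 : R)).
  by apply/funext => x; rewrite mul0r.
by rewrite LZ ?mul0r//; exact: cont_cst.
Qed.

Let L_sum (I : Type) (s : seq I) (f : I -> T -> R) : (forall i, continuous (f i)) ->
  continuous (fun x => \sum_(i <- s) f i x) /\
  L (fun x => \sum_(i <- s) f i x) = \sum_(i <- s) L (f i).
Proof.
move=> cf; elim: s => [|i s [IHc IH]].
  under eq_fun do rewrite big_nil.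
  by rewrite big_nil; split=> //; exact: cont_cst.
under eq_fun do rewrite big_cons.
by rewrite big_cons; split; [exact: cont_add|rewrite LD// IH].
Qed.

(** Covers consist of continuous functions instead of open sets: [L] applies to them directly, and a
    cover can be split by multiplying it by a partition of unity. *)
Definition daniell_cover (A : set T) : set (nat -> T -> R) :=
  [set f : nat -> T -> R | [/\ forall i, continuous (f i),
    forall i x, 0 <= f i x &
    forall x, A x -> (1 <= \sum_(i <oo) (f i x)%:E)%E]].

Definition daniell_outer (A : set T) : \bar R :=
  ereal_inf [set (\sum_(i <oo) (L (f i))%:E)%E | f in daniell_cover A].

Let mu := daniell_outer.

Local Open Scope ereal_scope.

Let cover_ge0 A f i : daniell_cover A f -> 0 <= (L (f i))%:E.
Proof. by move=> [cf f0 _]; rewrite lee_fin; apply: L_ge0. Qed.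

Let mu_le A f : daniell_cover A f -> mu A <= \sum_(i <oo) (L (f i))%:E.
Proof. by move=> cf; apply: ereal_inf_lbound; exists f. Qed.

Let mu_le1 (A : set T) (f : T -> R) : continuous f -> (forall x, (0 <= f x)%R) ->
  (forall x, A x -> (1 <= f x)%R) -> mu A <= (L f)%:E.
Proof.
move=> cf f0 f1.
pose F i := if i is 0%N then f else (fun=> 0%R).
have cF : daniell_cover A F.
  split; first by case=> //= _; exact: cont_cst.
    by case=> //= i x; exact: f0.
  move=> x Ax; apply: (le_trans _ (nneseries_lim_ge 1 _)) => [|i _ _].
    by rewrite big_nat1 lee_fin f1.
  by rewrite lee_fin; case: i.
apply: (le_trans (mu_le cF)).
rewrite nneseries_recl//; last by move=> i _; exact: cover_ge0 cF.
by rewrite eseries_cond/= eseries0 ?adde0// => -[|]//= k _ _; rewrite L0.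
Qed.

Lemma daniell_outer_ge0 A : 0 <= mu A.
Proof.
apply: le_ereal_inf_tmp => _ [f fA <-]; apply: nneseries_ge0 => i _ _.
exact: cover_ge0 fA.
Qed.

Lemma daniell_outer0 : mu set0 = 0.
Proof.
apply/eqP; rewrite eq_le daniell_outer_ge0 andbT.
have := @mu_le1 set0 (fun=> 0%R) (@cont_cst _ _ 0%R) (fun=> lexx _).
by rewrite L0; apply.
Qed.

Let mu_double A (F : nat -> nat -> T -> R) :
  (forall i j, continuous (F i j)) -> (forall i j x, (0 <= F i j x)%R) ->
  (forall x, A x -> 1 <= \sum_(i <oo) \sum_(j <oo) (F i j x)%:E) ->
  mu A <= \sum_(i <oo) \sum_(j <oo) (L (F i j))%:E.
Proof.
move=> cF F0 F1; have [e eP] := nneseries_nat_pair R.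
rewrite -(eP (fun i j => (L (F i j))%:E)); last first.
  by move=> i j; rewrite lee_fin; apply: L_ge0.
apply: (@mu_le _ (fun k => F (e k).1 (e k).2)); split=> // x Ax.
rewrite (eP (fun i j => (F i j x)%:E)); first exact: F1.
by move=> i j; rewrite lee_fin.
Qed.

Lemma daniell_outer_subadditive A (G : nat -> set T) :
  A `<=` \bigcup_n G n -> mu A <= \sum_(n <oo) mu (G n).
Proof.
move=> AG.
have [[i ioo]|] := pselect (exists i, mu (G i) = +oo).
  rewrite (@nneseries_pinfty _ _ xpredT i)// ?leey// => n _.
  exact: daniell_outer_ge0.
rewrite -forallNE => Gfin.
apply/lee_addgt0Pr => _/posnumP[e].
have /choice[F FP] : forall n, exists f, daniell_cover (G n) f /\
    \sum_(i <oo) (L (f i))%:E <= mu (G n) + (e%:num / (2 ^ n.+1)%:R)%:E.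
  move=> n.
  have fin : mu (G n) \is a fin_num.
    by rewrite ge0_fin_numE ?daniell_outer_ge0// ltey; apply/eqP.
  have [|_ [f fG <-] lef] :=
    @lb_ereal_inf_adherent _ _ (e%:num / (2 ^ n.+1)%:R)%R _ fin.
    by [].
  by exists f; split=> //; exact: ltW.
apply: (@le_trans _ _ (\sum_(n <oo) \sum_(i <oo) (L (F n i))%:E)).
  apply: mu_double.
  - by move=> i j; have [[h _ _] _] := FP i; exact: h.
  - by move=> i j x; have [[_ h _] _] := FP i; exact: h.
  - move=> x /AG[n _ Gnx]; have [[_ F0 /(_ _ Gnx) h] _] := FP n.
    apply: (le_trans h).
    have Fn0 i : 0 <= \sum_(j <oo) (F i j x)%:E.
      apply: nneseries_ge0 => j _ _; rewrite lee_fin.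
      by have [[_ h' _] _] := FP i; exact: h'.
    apply: (@le_trans _ _ (\sum_(0 <= i < n.+1) \sum_(j <oo) (F i j x)%:E)).
      by rewrite big_nat_recr//= leeDr//; apply: sume_ge0.
    exact: nneseries_lim_ge.
apply: (@le_trans _ _ (\sum_(n <oo) (mu (G n) + (e%:num / (2 ^ n.+1)%:R)%:E))).
  apply: lee_nneseries => [i _ _|n _]; last exact: (FP n).2.
  apply: nneseries_ge0 => j _ _; rewrite lee_fin; apply: L_ge0.
    by have [[h _ _] _] := FP i; exact: h.
  by move=> x _; have [[_ h _] _] := FP i; exact: h.
by rewrite epsilon_trick// => n; exact: daniell_outer_ge0.
Qed.

(* With [psi j := min 1 ((j+1) phi) - min 1 (j phi)], where [U = {phi > 0}], the
   [psi j] are nonnegative and sum up to the indicator of [U], so that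
   multiplying a cover of [X] by the [psi j] gives a cover of [X `&` U]. *)
Lemma daniell_outer_split (U X : set T) : open U ->
  mu (X `&` U) + mu (X `&` ~` U) <= mu X.
Proof.
move=> /open_cozero[phi [cphi phi0 ->{U}]]; set U := [set x | _].
apply: le_ereal_inf_tmp => _ [f fX <-]; have [cf f0 f1] := fX.
set SL := \sum_(i <oo) _.
have [->|SLfin] := eqVneq SL +oo; first by rewrite leey.
have SLge0 : 0 <= SL by apply: nneseries_ge0 => i _ _; exact: cover_ge0 fX.
have SLnum : SL \is a fin_num by rewrite ge0_fin_numE// ltey.
pose chi j x : R := Num.min 1%R (j%:R * phi x)%R.
have cchi j : continuous (chi j).
  by apply: cont_min; [exact: cont_cst|apply: cont_mul => //; exact: cont_cst].
have chi_le j x : (chi j x <= chi j.+1 x)%R.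
  rewrite /chi le_min ge_min lexx/= ge_min; apply/orP; right.
  by rewrite ler_wpM2r// ler_nat.
have chi1 j x : (chi j x <= 1)%R by rewrite /chi ge_min lexx.
pose psi j x : R := (chi j.+1 x - chi j x)%R.
have cpsi j : continuous (psi j) by exact: cont_sub.
have psi0 j x : (0 <= psi j x)%R by rewrite subr_ge0.
have sum_psi J x : (\sum_(0 <= j < J) psi j x = chi J x)%R.
  by rewrite telescope_sumr// /chi mul0r [X in (_ - X)%R]min_r// subr0.
have Lfpsi_ge0 i j : 0 <= (L (fun x => f i x * psi j x)%R)%:E.
  by rewrite lee_fin; apply: L_ge0 => [|x _]; [exact: cont_mul|exact: mulr_ge0].
(* Finitely many [psi j] at a time, since [L] is only finitely additive: the functions
   [f i * (1 - chi J)] still cover [X] outside [U], where [phi] vanishes, and together with the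
   [f i * psi j] for [j < J] they add up to [f i]. *)
have partial J : mu (X `&` ~` U) +
    \sum_(0 <= j < J) \sum_(i <oo) (L (fun x => f i x * psi j x)%R)%:E <= SL.
  have cg i : continuous (fun x => f i x * (1 - chi J x))%R.
    by apply: cont_mul => //; apply: cont_sub => //; exact: cont_cst.
  have g0 i x : (0 <= f i x * (1 - chi J x))%R.
    by apply: mulr_ge0 => //; rewrite subr_ge0.
  have hX : daniell_cover (X `&` ~` U) (fun i x => f i x * (1 - chi J x))%R.
    split=> // x [Xx /= /negP]; rewrite -leNgt => phix.
    have phi00 : phi x = 0%R by apply/eqP; rewrite eq_le phix phi0.
    have -> : \sum_(i <oo) (f i x * (1 - chi J x))%:E = \sum_(i <oo) (f i x)%:E.
      apply: eq_eseriesr => i _.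
      by rewrite /chi phi00 mulr0 min_r// subr0 mulr1.
    exact: f1.
  apply: (@le_trans _ _ (\sum_(i <oo) (L (fun x => f i x * (1 - chi J x))%R)%:E +
     \sum_(0 <= j < J) \sum_(i <oo) (L (fun x => f i x * psi j x)%R)%:E)).
    by apply: leeD => //; exact: mu_le hX.
  rewrite -nneseries_sum// -nneseriesD//; last 2 first.
    by move=> i _ _; exact: cover_ge0 hX.
    by move=> i _ _; apply: sume_ge0.
  rewrite le_eqVlt; apply/orP; left; apply/eqP; apply: eq_eseriesr => i _.
  have [cs Ls] := @L_sum _ (index_iota 0 J) (fun j x => f i x * psi j x)%R
    (fun j => cont_mul (cf i) (cpsi j)).
  rewrite sumEFin -EFinD -Ls -LD//; congr (L _)%:E; apply/funext => x.
  by rewrite -mulr_sumr sum_psi; ring.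
have hXU : mu (X `&` U) <=
    \sum_(j <oo) \sum_(i <oo) (L (fun x => f i x * psi j x)%R)%:E.
  apply: (@mu_double _ (fun j i x => f i x * psi j x)%R) => [j i|j i x|x [Xx Ux]].
  - exact: cont_mul.
  - exact: mulr_ge0.
  - have -> : \sum_(j <oo) \sum_(i <oo) (f i x * psi j x)%:E =
      \sum_(j <oo) ((psi j x)%:E * \sum_(i <oo) (f i x)%:E).
      apply: eq_eseriesr => j _; rewrite -nneseriesZl; last first.
        by move=> i _; rewrite lee_fin.
      by apply: eq_eseriesr => i _; rewrite -EFinM mulrC.
    apply: (@le_trans _ _ (\sum_(j <oo) (psi j x)%:E)); last first.
      apply: lee_nneseries => [j _ _|j _]; first by rewrite lee_fin.
      rewrite -{1}(mule1 (psi j x)%:E).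
      by apply: lee_wpmul2l => //; [rewrite lee_fin|exact: f1].
    (* This [J] exceeds the inverse of [phi x], so [chi J x = 1]: the first [J] terms already sum up
       to 1. *)
    pose J := (Num.truncn (phi x)^-1).+1.
    apply: (@le_trans _ _ (\sum_(0 <= j < J) (psi j x)%:E)); last first.
      by apply: nneseries_lim_ge => j _ _; rewrite lee_fin.
    rewrite sumEFin sum_psi lee_fin /chi le_min lexx/=.
    rewrite -ler_pdivrMr// div1r; apply/ltW; exact: truncnS_gt.
apply: (@le_trans _ _ (\sum_(j <oo) \sum_(i <oo) (L (fun x => f i x * psi j x)%R)%:E
   + mu (X `&` ~` U))); first exact: leeD2r.
have mfin : mu (X `&` ~` U) \is a fin_num.
  rewrite ge0_fin_numE ?daniell_outer_ge0//.
  have := partial 0%N; rewrite big_nil adde0 => /le_lt_trans; apply.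
  by rewrite ltey.
rewrite -leeBrDr//; apply: lime_le.
  by apply: is_cvg_nneseries => j _ _; exact: nneseries_ge0.
by near=> J; rewrite leeBrDr// addeC; exact: partial.
Unshelve. all: by end_near. Qed.

(** The constant 1 is itself a cover. Conversely, by compactness of [K], a finite partial sum of any
    cover is at least [1 - e] on all of [K], where positivity of [L] is tested. *)
Lemma daniell_outer_setT : mu setT = (L (fun=> 1%R))%:E.
Proof.
have c1 : continuous (fun _ : T => 1%R : R) by exact: cont_cst.
apply/eqP; rewrite eq_le (mu_le1 c1) ?andTb//.
apply: le_ereal_inf_tmp => _ [f fT <-]; have [cf f0 f1] := fT.
set SL := \sum_(i <oo) _; apply/lee_addgt0Pr => _/posnumP[eps].
set L1 := L (fun=> 1%R).
have L10 : (0 <= L1)%R by apply: L_ge0 => //; exact: cont_cst.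
(* This makes [e * L1] at most [eps]; the added 1 keeps the denominator positive when [L1 = 0]. *)
pose e : R := (eps%:num / (L1 + 1))%R.
have L1p : (0 < L1 + 1)%R by rewrite ltr_wpDl.
have e0 : (0 < e)%R by rewrite divr_gt0.
pose O n := [set x | (1 - e < \sum_(0 <= i < n) f i x)%R].
have cS n : continuous (fun x => \sum_(0 <= i < n) f i x)%R by exact: (L_sum _ _).1.
have oO n : open (O n).
  rewrite (_ : O n = (fun x => \sum_(0 <= i < n) f i x)%R @^-1`
    [set y | (1 - e < y)%R])//.
  by apply: open_comp => [x _|]; [exact: cS|exact: open_gt].
have KO : K `<=` \bigcup_n O n.
  move=> x Kx; apply: contrapT => nO.
  have := f1 x I; rewrite leNgt => /negP; apply.
  apply: (@le_lt_trans _ _ (1 - e)%:E); last by rewrite lte_fin ltrBlDr ltrDl.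
  apply: lime_le; first by apply: is_cvg_nneseries => i _ _; rewrite lee_fin.
  near=> n; rewrite sumEFin lee_fin leNgt; apply/negP => h.
  by apply: nO; exists n.
have := compactK; rewrite compact_cover => /(_ nat setT O (fun n _ => oO n) KO).
move=> [D _ KD].
pose N := (\max_(i <- enum_fset D) i)%N.
have KN x : K x -> (1 - e <= \sum_(0 <= i < N) f i x)%R.
  move=> /KD[n /= nD Onx]; apply: (le_trans (ltW Onx)).
  have nN : (n <= N)%N by exact: leq_bigmax_seq.
  by rewrite (big_cat_nat _ nN)//= lerDl; apply: sumr_ge0.
have h : ((1 - e) * L1 <= \sum_(0 <= i < N) L (f i))%R.
  rewrite -(L_sum (index_iota 0 N) cf).2 -LZ; last exact: cont_cst.
  apply: L_le => [|//|x Kx]; first by apply: cont_mul; exact: cont_cst.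
  by rewrite mulr1; exact: KN.
apply: (@le_trans _ _ ((1 - e) * L1 + eps%:num)%:E).
  rewrite lee_fin mulrBl mul1r -addrA lerDl addrC subr_ge0 /e.
  rewrite mulrAC ler_pdivrMr// ler_pM2l// lerDl//.
rewrite EFinD leeD2r//; apply: (le_trans (y := (\sum_(0 <= i < N) L (f i))%:E)).
  by rewrite lee_fin.
by rewrite -sumEFin; apply: nneseries_lim_ge => i _ _; exact: cover_ge0 fT.
Unshelve. all: by end_near. Qed.

(** Take [phi] positive exactly off [K]. Repeating it infinitely often covers the complement, and
    each copy costs [L phi = 0] because [phi] vanishes on [K]. *)
Lemma daniell_outer_setC : mu (~` K) = 0.
Proof.
apply/eqP; rewrite eq_le daniell_outer_ge0 andbT.
have /open_cozero[phi [cphi phi0 Kphi]] : open (~` K) by rewrite openC.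
have Lphi : L phi = 0%R.
  have c0 : continuous (fun _ : T => 0%R : R) by exact: cont_cst.
  rewrite -L0; apply/eqP; rewrite eq_le !L_le//= => x Kx.
  rewrite leNgt; apply/negP => h.
  by have : (~` K) x by rewrite Kphi.
have cov : daniell_cover (~` K) (fun=> phi).
  split=> // x; rewrite Kphi /= => phix.
  pose J := (Num.truncn (phi x)^-1).+1.
  apply: (@le_trans _ _ (\sum_(0 <= j < J) (phi x)%:E)); last first.
    by apply: nneseries_lim_ge => j _ _; rewrite lee_fin.
  rewrite sumEFin lee_fin sumr_const_nat subn0 -mulr_natl.
  rewrite -ler_pdivrMr// div1r; apply/ltW; exact: truncnS_gt.
by apply: (le_trans (mu_le cov)); rewrite Lphi eseries0.
Qed.

Lemma borel_caratheodory (OM : {outer_measure set T -> \bar R}) :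
  (OM : set T -> \bar R) = mu ->
  (measurable : set (set (borel T))) `<=` OM.-cara.-measurable.
Proof.
move=> OMmu; apply: smallest_sub.
  exact: (@sigma_algebra_measurable _ (caratheodory_type OM)).
move=> U oU; apply: le_caratheodory_measurable => X.
by rewrite OMmu; exact: daniell_outer_split.
Qed.

(* The inequality [integral_le] suffices: applied to [B - f] and [B + f] it gives
   equality, since both sides agree on constants. *)
Section integral.
Variable g : {finite_measure set (borel T) -> \bar R}.
Hypothesis gE : forall A, g A = mu A.

Let mK : measurable (K : set (borel T)). Proof. exact: closed_borel. Qed.

Let mcont (D : set (borel T)) (f : T -> R) : continuous f ->
  measurable_fun D (fun x : borel T => (f x)%:E).
Proof.
move=> cf; apply/measurable_EFinP.
apply: measurable_funTS; exact: continuous_borel_real.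
Qed.

Let mpos (f : T -> R) : continuous f ->
  measurable ([set x | (0 < f x)%R] : set (borel T)).
Proof.
move=> cf; apply: open_borel.
apply: (@open_comp _ _ f [set y : R | (0 < y)%R]) => [x _|]; first exact: cf.
exact: open_gt.
Qed.

(** Induction on the number of layers of height [e], removing the bottom layer [h2]. The error does
    not accumulate: the one coming from [h1] is [e] times the mass of [h1 > 0], where [h2 = e], and
    so is absorbed by [L h2]. Only the error of the bottom layer is left. *)
Let integral_layer (e : R) (n : nat) (h : T -> R) : (0 < e)%R -> continuous h ->
  (forall x, (0 <= h x)%R) -> (forall x, K x -> (h x <= n%:R * e)%R) ->
  \int[g]_(x in K) (h x)%:E <= (L h)%:E + e%:E * g [set x | (0 < h x)%R].
Proof.
move=> e0; elim: n h => [|n IH] h ch h0 hn.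
  rewrite (eq_integral (fun=> 0)) => [|x /set_mem Kx]; last first.
    by congr _%:E; apply/eqP; rewrite eq_le h0 andbT -[leRHS](mul0r e) hn.
  rewrite integral0; apply: adde_ge0; first by rewrite lee_fin; exact: L_ge0.
  by apply: mule_ge0 => //; rewrite lee_fin ltW.
pose h1 x := Num.max (h x - e)%R 0%R; pose h2 x := Num.min (h x) e.
have hE x : (h x = h1 x + h2 x)%R.
  by rewrite /h1 /h2; case: (leP (h x) e) => he; case: (leP (h x - e)%R 0%R) => ?; lra.
have ch1 : continuous h1.
  by apply: cont_max; [apply: cont_sub => //; exact: cont_cst|exact: cont_cst].
have ch2 : continuous h2 by apply: cont_min => //; exact: cont_cst.
have h10 x : (0 <= h1 x)%R by rewrite /h1 le_max lexx orbT.
have h20 x : (0 <= h2 x)%R by rewrite /h2 le_min h0 ltW.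
have h1n x : K x -> (h1 x <= n%:R * e)%R.
  move=> Kx; rewrite /h1 ge_max; apply/andP; split.
    by have := hn _ Kx; rewrite -natr1 mulrDl mul1r; lra.
  by rewrite mulr_ge0// ltW.
have mh1 : e%:E * g [set x | (0 < h1 x)%R] <= (L h2)%:E.
  have ci : continuous (fun x => e^-1 * h2 x)%R.
    by apply: cont_mul => //; exact: cont_cst.
  rewrite gE muleC -lee_pdivlMr// -EFinM mulrC -LZ//.
  apply: mu_le1 => // [x|x]; first by rewrite mulr_ge0// invr_ge0 ltW.
  rewrite /= /h1 lt_max ltxx orbF subr_gt0 => ex.
  by rewrite /h2 min_r ?mulVf ?gt_eqF// ltW.
have I2 : \int[g]_(x in K) (h2 x)%:E <= e%:E * g [set x | (0 < h x)%R].
  have mh := mpos ch.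
  apply: (@le_trans _ _ (\int[g]_(x in K) (e%:E * (\1_[set x | (0 < h x)%R] x)%:E))).
    apply: ge0_le_integral => //.
    - by move=> x _; rewrite lee_fin.
    - exact: mcont.
    - by apply: measurable_funeM; apply/measurable_EFinP; exact: measurable_indic.
    - move=> x _; rewrite -EFinM lee_fin indicE; case: (boolP (x \in _)) => hx.
        by rewrite mulr1 /h2 ge_min lexx orbT.
      rewrite mulr0 /h2 ge_min; apply/orP; left.
      by rewrite leNgt; apply: contra hx => hx; exact: mem_set.
  rewrite ge0_integralZl//; first last.
  - by rewrite lee_fin ltW.
  - by apply/measurable_EFinP; exact: measurable_indic.
  rewrite integral_indic//; apply: lee_wpmul2l; first by rewrite lee_fin ltW.
  exact: (le_measure g (mem_set (measurableI _ _ mh mK)) (mem_set mh)).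
have -> : \int[g]_(x in K) (h x)%:E =
    \int[g]_(x in K) (h1 x)%:E + \int[g]_(x in K) (h2 x)%:E.
  rewrite -ge0_integralD//; first last.
  - exact: mcont.
  - by move=> x _; rewrite lee_fin.
  - exact: mcont.
  - by move=> x _; rewrite lee_fin.
  by apply: eq_integral => x _; rewrite hE.
have -> : (L h)%:E = (L h1)%:E + (L h2)%:E.
  by rewrite -EFinD -LD//; congr (L _)%:E; apply/funext.
apply: leeD => //; apply: (le_trans (IH _ ch1 h10 h1n)).
exact: leeD2l.
Qed.

Let integral_le (h : T -> R) (B : R) : continuous h ->
  (forall x, (0 <= h x)%R) -> (forall x, K x -> (h x <= B)%R) ->
  \int[g]_(x in K) (h x)%:E <= (L h)%:E.
Proof.
move=> ch h0 hB; apply/lee_addgt0Pr => _/posnumP[eps].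
have L10 : (0 <= L (fun=> 1%R))%R by apply: L_ge0 => //; exact: cont_cst.
have L1p : (0 < L (fun=> 1%R) + 1)%R by rewrite ltr_wpDl.
pose e : R := (eps%:num / (L (fun=> 1%R) + 1))%R.
have e0 : (0 < e)%R by rewrite divr_gt0.
apply: (le_trans (@integral_layer e (Num.truncn (B / e)).+1 h e0 ch h0 _)).
  move=> x Kx; apply: (le_trans (hB _ Kx)); rewrite -ler_pdivrMr//.
  exact/ltW/truncnS_gt.
rewrite leeD2l//; apply: (@le_trans _ _ (e%:E * g setT)).
  apply: lee_wpmul2l; first by rewrite lee_fin ltW.
  exact: (le_measure g (mem_set (mpos ch)) (mem_set measurableT)).
rewrite gE daniell_outer_setT -EFinM lee_fin /e mulrAC ler_pdivrMr//.
by rewrite ler_pM2l// lerDl.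
Qed.

Lemma daniell_integral (f : T -> R) : continuous f ->
  \int[g]_(x in K) (f x)%:E = (L f)%:E.
Proof.
move=> cf.
have [B0 fB0] := continuous_compact_bound compactK (continuous_subspaceT cf).
pose B := Num.max B0 0%R.
have B0' : (0 <= B)%R by rewrite /B le_max lexx orbT.
have fB x : K x -> (`|f x| <= B)%R by move=> /fB0 h; rewrite /B le_max h.
have LC c : L (fun=> c) = (c * L (fun=> 1%R))%R.
  by rewrite -LZ; [congr L; apply/funext => x; rewrite mulr1|exact: cont_cst].
have intf : g.-integrable K (EFin \o f).
  exact: bounded_continuous_integrable fB.
have intC c : g.-integrable K (EFin \o (fun=> c)).
  by apply: (@bounded_continuous_integrable _ _ _ _ _ `|c|%R) => //; exact: cont_cst.
have gK : g K = (L (fun=> 1%R))%:E.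
  rewrite -daniell_outer_setT -gE -(setUv K) measureU//; last 2 first.
  - exact: measurableC.
  - by rewrite setICr.
  by rewrite [X in _ + X]gE daniell_outer_setC adde0.
have step (s : R) (cs : continuous (fun x => s * f x)%R) : (`|s| = 1)%R ->
    \int[g]_(x in K) (s * f x)%:E <= (s * L f)%:E.
  move=> s1.
  have sfB x : K x -> (`|s * f x| <= B)%R by rewrite normrM s1 mul1r; exact: fB.
  have ints : g.-integrable K (EFin \o (fun x => s * f x)%R).
    exact: bounded_continuous_integrable sfB.
  (* Taking the maximum with 0 changes nothing on [K], but makes the function nonnegative
     everywhere, as [integral_le] requires. *)
  pose h x := Num.max (s * f x + B)%R 0%R.
  have hK x : K x -> (h x = s * f x + B)%R.
    move=> /sfB; rewrite ler_norml => /andP[l _].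
    by rewrite /h max_l//; lra.
  have csB : continuous (fun x => s * f x + B)%R.
    by apply: cont_add => //; exact: cont_cst.
  have ch : continuous h by apply: cont_max => //; exact: cont_cst.
  have h0 x : (0 <= h x)%R by rewrite /h le_max lexx orbT.
  have := @integral_le h (B + B)%R ch h0.
  have -> : L h = (s * L f + B * L (fun=> 1%R))%R.
    have cB : continuous (fun _ : T => B : R) by exact: cont_cst.
    rewrite -LC -LZ// -LD//.
    by apply/eqP; rewrite eq_le; apply/andP; split; apply: L_le => // x Kx; rewrite hK.
  have -> : \int[g]_(x in K) (h x)%:E =
     \int[g]_(x in K) (s * f x)%:E + (B * L (fun=> 1%R))%:E.
    rewrite (eq_integral (fun x : borel T =>
      (EFin \o (fun x => s * f x)%R) x + (EFin \o (fun=> B)) x)); last first.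
      by move=> x /set_mem Kx; rewrite hK.
    rewrite (integralD mK ints (intC B)); congr (_ + _).
    by have := integral_cst g mK B%:E; rewrite [X in _ * X]gK -EFinM => <-.
  rewrite EFinD leeD2rE//; apply => x Kx; rewrite hK//.
  by rewrite lerD2r; have := sfB _ Kx; rewrite ler_norml => /andP[].
apply/eqP; rewrite eq_le; apply/andP; split.
  have := step 1%R; rewrite mul1r normr1.
  under eq_fun do rewrite mul1r.
  by under eq_integral do rewrite mul1r; apply.
have := step (-1)%R; rewrite mulN1r normrN1.
under eq_fun do rewrite mulN1r.
under eq_integral do rewrite mulN1r EFinN.
rewrite integralN//=; last exact: integrable_add_def.
rewrite EFinN leeNl oppeK; apply => //.
by move=> x; apply: cvgN; exact: cf.
Qed.

End integral.

(** The outer measure is countably additive on its Caratheodory sets, which include the Borel sets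
    by [daniell_outer_split]; it is finite because the whole space has measure [L 1]. *)
Lemma riesz_compact : exists g : {finite_measure set (borel T) -> \bar R},
  g (~` K) = 0 /\
  forall f : T -> R, continuous f -> \int[g]_(x in K) (f x)%:E = (L f)%:E.
Proof.
pose om := isSubsetOuterMeasure.Build R T mu daniell_outer0 daniell_outer_ge0
  daniell_outer_subadditive.
pose OM : {outer_measure set T -> \bar R} := HB.pack mu om.
have sub := @borel_caratheodory OM erefl.
pose m : set (borel T) -> \bar R := mu.
have m_sigma : semi_sigma_additive m.
  move=> F mF tF mUF; apply: (@caratheodory_measure_sigma_additive _ _ OM) => //.
    by move=> i; exact: (sub _ (mF i)).
  exact: sub.
have m_fin : fin_num_fun m.
  move=> A mA; rewrite ge0_fin_numE; last exact: daniell_outer_ge0.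
  apply: (@le_lt_trans _ _ (mu setT)); first exact: (le_outer_measure OM).
  by rewrite daniell_outer_setT ltry.
pose ms := isMeasure.Build _ _ _ m daniell_outer0 daniell_outer_ge0 m_sigma.
pose M0 : {measure set (borel T) -> \bar R} := HB.pack m ms.
pose mf := Measure_isFinite.Build _ (borel T) R M0 m_fin.
pose G : {finite_measure set (borel T) -> \bar R} := HB.pack m ms mf.
exists G; split; first exact: daniell_outer_setC.
by move=> f cf; exact: daniell_integral.
Qed.

End daniell.
(** * Euclidean distance and bounded domains *)

Section inf_lemmas.
Variables (R : realType) (I : Type) (A : set I).

Lemma inf_image_le (F : I -> R) (c : R) (a : I) :
  (forall a, A a -> c <= F a) -> A a -> inf [set F a | a in A] <= F a.
Proof.
move=> cF Aa; apply: ge_inf; last by exists a.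
by exists c => _ [b Ab <-]; exact: cF.
Qed.

Lemma le_inf_image (F : I -> R) (c : R) : A !=set0 ->
  (forall a, A a -> c <= F a) -> c <= inf [set F a | a in A].
Proof.
move=> [a Aa] cF; apply: lb_le_inf; first by exists (F a), a.
by move=> _ [b Ab <-]; exact: cF.
Qed.

Lemma inf_image_dist (F G : I -> R) (cF cG e : R) : A !=set0 ->
  (forall a, A a -> cF <= F a) -> (forall a, A a -> cG <= G a) ->
  (forall a, A a -> `|F a - G a| <= e) ->
  `|inf [set F a | a in A] - inf [set G a | a in A]| <= e.
Proof.
move=> A0 FP GP FG; rewrite ler_distl; apply/andP; split.
  apply: le_inf_image => // a Aa; rewrite lerBlDr.
  apply: (le_trans (inf_image_le GP Aa)).
  by have := FG _ Aa; rewrite ler_distl => /andP[]; rewrite lerBlDr.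
rewrite -lerBlDr; apply: le_inf_image => // a Aa; rewrite lerBlDr.
apply: (le_trans (inf_image_le FP Aa)).
by have := FG _ Aa; rewrite ler_distl => /andP[].
Qed.

End inf_lemmas.

Section normed_module.
Variables (R : realType) (V : normedModType R).

Lemma lipschitz_continuous (f : V -> R) :
  (forall x y, `|f x - f y| <= `|x - y|) -> continuous f.
Proof.
move=> flip x; apply/cvgrPdist_lt => e e0; near=> y.
apply: (le_lt_trans (flip x y)); near: y.
exact: (@cvgr_dist_lt _ _ _ _ _ id x).
Unshelve. all: by end_near. Qed.

(** The distance to the complement of [U] works. An empty complement is treated apart, because the
    real infimum of the empty set is 0 by convention. *)
Lemma open_cozero_set (U : set V) : open U ->
  exists phi : V -> R, [/\ continuous phi, forall x, 0 <= phi x &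
    U = [set x | 0 < phi x]].
Proof.
move=> oU; have [UT|/set0P U0] := eqVneq (~` U) set0.
  exists (fun=> 1); split=> //; first by move=> x; exact: cvg_cst.
  apply/seteqP; split=> x _ /=; first exact: ltr01.
  by apply: contrapT => nUx; have : (~` U) x by []; rewrite UT.
pose phi x := inf [set `|x - a| | a in ~` U].
have phi0 x : 0 <= phi x by exact: le_inf_image.
exists phi; split=> //.
  apply: lipschitz_continuous => x y.
  apply: (@inf_image_dist _ _ _ _ _ 0 0) => // a _.
  by rewrite (le_trans (ler_dist_dist _ _))// opprB addrA subrK.
apply/seteqP; split=> x.
  move=> Ux; have [e /= e0 eU] := (nbhs_ballP _ _).1 (open_nbhs_nbhs (conj oU Ux)).
  apply: (lt_le_trans e0); apply: le_inf_image => // a nUa.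
  by rewrite leNgt; apply/negP => xa; apply: nUa; apply: eU; rewrite -ball_normE.
rewrite /= lt_neqAle => /andP[/eqP phix _]; apply: contrapT => nUx; apply: phix.
apply/eqP; rewrite eq_le phi0/=.
have := @inf_image_le _ _ (~` U) (fun a => `|x - a|) 0 x.
by rewrite subrr normr0; apply.
Qed.

(** Tietze's extension theorem, with a bound made positive as that theorem requires. *)
Lemma compact_extension (A : set V) (f : V -> R) : compact A ->
  {within A, continuous f} ->
  exists (g : V -> R) (M : R), [/\ continuous g, forall x, `|g x| <= M &
    forall x, A x -> g x = f x].
Proof.
move=> cA cf.
have [M fM] := continuous_compact_bound cA cf.
have M0 : 0 < `|M| + 1 by rewrite ltr_wpDl.
have [|||g [gf cg gM]] := @continuous_bounded_extension V R _ A _ f _ M0 cf.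
- exact: pseudometric_normal.
- by apply: compact_closed => //; exact: norm_hausdorff.
- move=> x /fM /le_trans; apply; rewrite (le_trans (ler_norm M))//.
  by rewrite lerDl.
exists g, (`|M| + 1); split=> // x Ax.
by rewrite -gf//; exact: mem_set.
Qed.

End normed_module.

(** * The Euclidean distance and inf-convolution with it *)

Section euclidean.
Variables (R : realType) (d : nat).
Local Notation E := 'rV[R]_d.
Implicit Types x y z : E.

(** With [p], [q] the two norms and [C] the scalar product, the sum of the squares of
    [q * a i - p * b i] equals [2 * (p * q) * (p * q - C)]. If a norm is zero, all the terms of [C]
    vanish. *)
Lemma cauchy_schwarz_sum (n : nat) (a b : 'I_n -> R) :
  \sum_i a i * b i <= Num.sqrt (\sum_i a i ^+ 2) * Num.sqrt (\sum_i b i ^+ 2).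
Proof.
set p := Num.sqrt _; set q := Num.sqrt _; set C := \sum_i _.
have p0 : 0 <= p by exact: sqrtr_ge0.
have q0 : 0 <= q by exact: sqrtr_ge0.
have pE : \sum_i a i ^+ 2 = p ^+ 2.
  by rewrite sqr_sqrtr//; apply: sumr_ge0 => i _; exact: sqr_ge0.
have qE : \sum_i b i ^+ 2 = q ^+ 2.
  by rewrite sqr_sqrtr//; apply: sumr_ge0 => i _; exact: sqr_ge0.
have nul (c : 'I_n -> R) : \sum_i c i ^+ 2 = 0 -> forall i, c i = 0.
  move=> c0 i; apply/eqP; rewrite -sqrf_eq0; apply/eqP.
  by apply: (psumr_eq0P _ c0) => // j _; exact: sqr_ge0.
have [p00|pn0] := eqVneq p 0.
  have a0 := nul a; rewrite pE p00 expr0n in a0.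
  by rewrite p00 mul0r /C big1// => i _; rewrite a0// mul0r.
have [q00|qn0] := eqVneq q 0.
  have b0 := nul b; rewrite qE q00 expr0n in b0.
  by rewrite q00 mulr0 /C big1// => i _; rewrite b0// mulr0.
have : 0 <= \sum_i (q * a i - p * b i) ^+ 2 by apply: sumr_ge0 => i _; exact: sqr_ge0.
have -> : \sum_i (q * a i - p * b i) ^+ 2 =
    q ^+ 2 * \sum_i a i ^+ 2 - (2 * p * q) * C + p ^+ 2 * \sum_i b i ^+ 2.
  rewrite /C !mulr_sumr -sumrB -big_split/=; apply: eq_bigr => i _; ring.
rewrite pE qE.
have pq : 0 < p * q by rewrite mulr_gt0// lt_neqAle eq_sym ?pn0 ?qn0.
have -> : q ^+ 2 * p ^+ 2 - 2 * p * q * C + p ^+ 2 * q ^+ 2 =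
  2 * (p * q) * (p * q - C) by ring.
have pq2 : 0 < 2 * (p * q) by rewrite mulr_gt0.
by move=> h; rewrite -subr_ge0 -(pmulr_rge0 _ pq2).
Qed.

Lemma eucl_dist_ge0 x y : 0 <= eucl_dist x y.
Proof. exact: sqrtr_ge0. Qed.

Lemma eucl_distxx x : eucl_dist x x = 0.
Proof.
by rewrite /eucl_dist big1 ?sqrtr0// => i _; rewrite subrr expr0n.
Qed.

Lemma eucl_distC x y : eucl_dist x y = eucl_dist y x.
Proof.
by congr Num.sqrt; apply: eq_bigr => i _; rewrite -sqrrN opprB.
Qed.

Lemma eucl_dist_triangle x y z :
  eucl_dist x z <= eucl_dist x y + eucl_dist y z.
Proof.
rewrite -[leRHS]ger0_norm ?addr_ge0 ?eucl_dist_ge0// -sqrtr_sqr ler_wsqrtr//.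
rewrite sqrrD !sqr_sqrtr; try by apply: sumr_ge0 => i _; exact: sqr_ge0.
have := cauchy_schwarz_sum (fun i => x ord0 i - y ord0 i)
  (fun i => y ord0 i - z ord0 i).
rewrite -/(eucl_dist x y) -/(eucl_dist y z) => cs.
have -> : \sum_i (x ord0 i - z ord0 i) ^+ 2 = \sum_i (x ord0 i - y ord0 i) ^+ 2 +
   (\sum_i (x ord0 i - y ord0 i) * (y ord0 i - z ord0 i)) *+ 2 +
   \sum_i (y ord0 i - z ord0 i) ^+ 2.
  rewrite -sumrMnl -!big_split/=; apply: eq_bigr => i _; ring.
by rewrite lerD2r lerD2l lerMn2r.
Qed.

Lemma continuous_eucl_dist (T : topologicalType) (f g : T -> E) :
  continuous f -> continuous g -> continuous (fun t => eucl_dist (f t) (g t)).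
Proof.
move=> cf cg t; apply: (@continuous_comp _ _ _
  (fun t => \sum_(i < d) (f t ord0 i - g t ord0 i) ^+ 2) Num.sqrt).
  apply: cvg_big => [|i _]; first exact: add_continuous.
  apply: (@cvg_comp _ _ _ (fun t => f t ord0 i - g t ord0 i)
    (fun r : R => r ^+ 2)); last exact: exprn_continuous.
  apply: cvgB.
    apply: (@continuous_comp _ _ _ f (fun x : E => x ord0 i)); first exact: cf.
    exact: coord_continuous.
  apply: (@continuous_comp _ _ _ g (fun x : E => x ord0 i)); first exact: cg.
  exact: coord_continuous.
exact: sqrt_continuous.
Qed.

Lemma Lip1_continuous (A : set E) (phi : E -> R) :
  Lip1 A phi -> {within A, continuous phi}.
Proof.
move=> phil; apply/subspace_continuousP => x Ax.
apply/cvgrPdist_lt => e e0.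
have cx : continuous (fun y => eucl_dist x y).
  by apply: (@continuous_eucl_dist E (fun=> x) id) => y;
    [exact: cst_continuous|exact: cvg_id].
have := (cvgrPdist_lt _ _).1 (cx x) e e0; rewrite eucl_distxx => ne.
rewrite near_withinE; near=> y => Ay.
apply: (le_lt_trans (phil _ _ (mem_set Ax) (mem_set Ay))).
have : `|0 - eucl_dist x y| < e by near: y; exact: ne.
by rewrite sub0r normrN ger0_norm ?eucl_dist_ge0.
Unshelve. all: by end_near. Qed.

(** The Pasch-Hausdorff envelope: on a nonempty [A] where [f] is bounded below, it is the largest
    1-Lipschitz minorant of [f]. *)
Definition infconv (A : set E) (f : E -> R) x : R :=
  inf [set f y + eucl_dist x y | y in A].

Section infconv.
Variables (A : set E) (f : E -> R) (c : R).
Hypothesis A0 : A !=set0.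
Hypothesis fc : forall y, A y -> c <= f y.

Let fdc x y : A y -> c <= f y + eucl_dist x y.
Proof. by move=> /fc cf; rewrite (le_trans cf)// lerDl eucl_dist_ge0. Qed.

Lemma infconv_le x y : A y -> infconv A f x <= f y + eucl_dist x y.
Proof. by move=> Ay; exact: (inf_image_le (fdc x)). Qed.

Lemma le_infconv x b : (forall y, A y -> b <= f y + eucl_dist x y) ->
  b <= infconv A f x.
Proof. exact: le_inf_image. Qed.

Lemma infconv_lip x y : `|infconv A f x - infconv A f y| <= eucl_dist x y.
Proof.
apply: (inf_image_dist A0 (fdc x) (fdc y)) => z _.
rewrite opprD addrACA subrr add0r ler_distl.
have := eucl_dist_triangle x y z; have := eucl_dist_triangle y x z.
by rewrite (eucl_distC y x) => h1 h2; apply/andP; split; lra.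
Qed.

End infconv.

End euclidean.

(** * Closure and boundary of a bounded domain *)

Section domain.
Variables (R : realType) (d : nat) (Omega : set 'rV[R]_d).
Hypothesis domOmega : bounded_domain Omega.
Local Notation E := 'rV[R]_d.
Local Notation K := (closure Omega).
Local Notation bd := (boundary Omega).

Let oOmega : open Omega. Proof. by case: domOmega. Qed.

Lemma compact_domain : compact K.
Proof.
case: domOmega => _ _ _ [M [_ bM]].
apply: bounded_closed_compact; last exact: closed_closure.
exists (M + 1); split; first exact: num_real.
move=> N MN x; rewrite closureE.
apply: (@smallest_sub _ closed Omega [set x : E | `|x| <= N]).
- rewrite (_ : mkset _ = (fun x : E => `|x|) @^-1` [set y | y <= N])//.
  by apply: closed_comp => [y _|]; [exact: norm_continuous|exact: closed_le].
- by move=> y Oy; apply: bM => //; rewrite (lt_trans _ MN)// ltrDl.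
Qed.

Lemma boundaryE : bd = K `&` ~` Omega.
Proof. by rewrite /boundary (interior_id _).1// setDE. Qed.

Lemma closure_split : K = Omega `|` bd.
Proof.
rewrite boundaryE; apply/seteqP; split=> x.
  by have [Ox|nOx] := pselect (Omega x) => Kx; [left|right].
by case=> [Ox|[]//]; exact: subset_closure.
Qed.

Lemma boundary_subset : bd `<=` K.
Proof. by move=> x []. Qed.

Lemma closed_boundary : closed bd.
Proof.
rewrite boundaryE; apply: closedI; first exact: closed_closure.
exact: open_closedC.
Qed.

Lemma compact_boundary : compact bd.
Proof. exact: subclosed_compact closed_boundary compact_domain boundary_subset. Qed.

(** Otherwise [Omega] is open and closed, so it contains every line through one of its points, lines
    being connected; this contradicts boundedness. A direction [c] other than 0 exists because [d]
    is positive. *)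
Lemma boundary_neq0 : (0 < d)%N -> bd !=set0.
Proof.
move=> d0; apply/set0P/negP => /eqP bd0.
case: domOmega => _ _ [x0 Ox0] [M [_ bM]].
have cO : closed Omega.
  rewrite (_ : Omega = K); first exact: closed_closure.
  by rewrite [RHS]closure_split bd0 setU0.
pose c : E := const_mx 1.
have c0 : 0 < `|c|.
  rewrite normr_gt0; apply/eqP => /matrixP /(_ ord0 (Ordinal d0)).
  by rewrite !mxE => /eqP; rewrite oner_eq0.
pose l (t : R) : E := x0 + t *: c.
have cl : continuous l.
  by move=> t; apply: cvgD; [exact: cvg_cst|apply: cvgZr_tmp; exact: cvg_id].
have conn : connected (l @` setT).
  apply: connected_continuous_connected; last exact: continuous_subspaceT.
  exact/connected_intervalP.
have lO : (l @` setT) `&` Omega = l @` setT.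
  apply: conn.
  - by exists x0; split=> //; exists 0 => //; rewrite /l scale0r addr0.
  - by exists Omega.
  - by exists Omega.
have Mt t : `|l t| <= M + 1.
  apply: (bM (M + 1)); first by rewrite ltrDl.
  have : (l @` setT) (l t) by exists t.
  by rewrite -lO => -[].
(* At this parameter the displacement from [x0] has norm [M + 1 + |x0| + 1], so the point has norm
   at least [M + 2]. *)
have := Mt ((M + 1 + `|x0| + 1) / `|c|).
have M0 : 0 <= M + 1 by rewrite (le_trans _ (Mt 0)).
rewrite leNgt => /negP; apply.
have := ler_normD (l ((M + 1 + `|x0| + 1) / `|c|)) (- x0).
rewrite normrN {1}/l addrAC subrr add0r normrZ ger0_norm; last first.
  by apply: divr_ge0 => //; have := normr_ge0 x0; lra.
rewrite divfK ?gt_eqF//; lra.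
Qed.

End domain.

(** * Marginals of transport plans *)

Section transport_integrals.
Variable R : realType.

(** Marginals are bare set functions; rewriting them as [P] makes the results on integrals against
    measures applicable. *)
Lemma pushforward_measure d1 d2 (T1 : measurableType d1) (T2 : measurableType d2)
    (m : {measure set T1 -> \bar R}) (f : T1 -> T2) : measurable_fun setT f ->
  exists P : {measure set T2 -> \bar R}, (P : set T2 -> \bar R) = pushforward m f.
Proof.
by move=> mf; unshelve eexists (pushforward m f : {measure set T2 -> \bar R}).
Qed.

(** The integrands increase to the indicator of [phi > 0], so monotone convergence applies. This
    carries equalities between integrals of continuous functions over to open sets. *)
Lemma integral_cozero_cvg (T : ptopologicalType)
    (m : {finite_measure set (borel T) -> \bar R}) (D : set (borel T))
    (phi : T -> R) : measurable D -> continuous phi -> (forall x, 0 <= phi x) ->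
  (\int[m]_(x in D) (Num.min 1 (k%:R * phi x))%:E)%E @[k --> \oo] -->
    m ([set x | 0 < phi x] `&` D).
Proof.
move=> mD cphi phi0.
have mU : measurable ([set x | 0 < phi x] : set (borel T)).
  apply: open_borel; apply: (@open_comp _ _ phi [set y : R | 0 < y]) => [x _|].
    exact: cphi.
  exact: open_gt.
pose u (k : nat) (x : borel T) : \bar R := (Num.min 1 (k%:R * phi x))%:E.
have mu k : measurable_fun D (u k).
  apply/measurable_EFinP; apply: measurable_funTS.
  apply: (@continuous_borel_real _ _ (fun x => Num.min 1 (k%:R * phi x))).
  by apply: cont_min; [exact: cont_cst|apply: cont_mul => //; exact: cont_cst].
have u0 k x : D x -> (0 <= u k x)%E.
  by move=> _; rewrite lee_fin le_min ler01 mulr_ge0.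
have und x : D x -> {homo u^~ x : n k / (n <= k)%N >-> (n <= k)%E}.
  move=> _ n k nk; rewrite lee_fin le_min ge_min lexx/= ge_min; apply/orP; right.
  by rewrite ler_wpM2r// ler_nat.
have lim_u x : limn (u^~ x) = (\1_[set x | 0 < phi x] x)%:E.
  apply/cvg_lim => //; rewrite indicE; case: (boolP (x \in _)) => [/set_mem /= px|px].
    apply: cvg_near_cst; near=> k; rewrite /u min_l//.
    rewrite -ler_pdivrMr// div1r; apply: ltW; near: k; exact: nbhs_infty_gtr.
  apply: cvg_near_cst; near=> k; rewrite /u.
  have -> : phi x = 0.
    apply/eqP; rewrite eq_le phi0 andbT leNgt; apply: contra px => px.
    exact: mem_set.
  by rewrite mulr0 min_r.
have := @cvg_monotone_convergence _ _ _ m D mD u mu u0 und.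
under [X in _ --> X -> _]eq_integral do rewrite lim_u.
by rewrite integral_indic.
Unshelve. all: by end_near. Qed.

Section marginal.
Variables (d : nat) (Omega : set 'rV[R]_d).
Hypothesis domOmega : bounded_domain Omega.
Local Notation E := 'rV[R]_d.
Local Notation K := (closure Omega).
Local Notation K2 := (closure Omega `*` closure Omega).
Local Notation bd := (boundary Omega).

Variables (gamma : {finite_measure set (borel (E * E)%type) -> \bar R})
  (f : {finite_measure set (borel E) -> \bar R}) (p : E * E -> E).
Hypothesis gammaK : concentrated_on gamma K2.
Hypothesis p_cont : continuous p.
Hypothesis pK : forall z, K2 z -> K (p z).

Let mOmega : measurable (Omega : set (borel E)).
Proof. by apply: open_borel; case: domOmega. Qed.

Let mbd : measurable (bd : set (borel E)).
Proof. by apply: closed_borel; exact: closed_boundary. Qed.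

Let mK : measurable (K : set (borel E)).
Proof. by apply: closed_borel; exact: closed_closure. Qed.

Let mp : measurable_fun setT (p : borel (E * E)%type -> borel E).
Proof. exact: continuous_borel. Qed.

Lemma closed_K2 : closed K2.
Proof.
rewrite (_ : K2 = (fst : E * E -> E) @^-1` K `&` (snd : E * E -> E) @^-1` K)//.
by apply: closedI; apply: closed_comp; [move=> z _; exact: cvg_fst|exact: closed_closure
  |move=> z _; exact: cvg_snd|exact: closed_closure].
Qed.

Let mK2 : measurable (K2 : set (borel (E * E)%type)).
Proof. by apply: closed_borel; exact: closed_K2. Qed.

Let mpre (D : set (borel E)) : measurable D ->
  measurable (p @^-1` D : set (borel (E * E)%type)).
Proof. by move=> mD; rewrite -[X in measurable X]setTI; exact: mp. Qed.

(** The integral of [h] composed with [p] splits into the parts where [p z] lies in [Omega] and on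
    the boundary; the marginal constraint identifies the first part. Boundary integrals thus become
    integrals against the plan, up to a term that does not depend on the plan. *)
Lemma marginal_integral (h : E -> R) (M : R) :
  restriction_eq Omega
    (pushforward gamma (p : borel (E * E)%type -> borel E)) f ->
  continuous h -> (forall x, K x -> `|h x| <= M) ->
  (\int[pushforward gamma (p : borel (E * E)%type -> borel E)]_(x in bd) (h x)%:E =
   (\int[gamma]_(z in K2) h (p z) - \int[f]_(x in Omega) h x)%:E)%E.
Proof.
move=> req ch hM.
have chp : continuous (fun z => h (p z)).
  by move=> z; apply: continuous_comp; [exact: p_cont|exact: ch].
have mh : measurable_fun setT (fun x : borel E => (h x)%:E).
  by apply/measurable_EFinP; exact: continuous_borel_real.
have inth (D : set (borel E)) : measurable D -> D `<=` K ->
    gamma.-integrable (p @^-1` D) (fun z => (h (p z))%:E).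
  move=> mD DK; apply: (@bounded_continuous_integrable _ _ _ _ (fun z => h (p z)) M) => //.
    exact: mpre.
  by move=> z /DK /hM.
have push (D : set (borel E)) : measurable D -> D `<=` K ->
    (\int[pushforward gamma (p : borel (E * E)%type -> borel E)]_(x in D) (h x)%:E =
    \int[gamma]_(z in p @^-1` D) (h (p z))%:E)%E.
  by move=> mD DK; apply: integral_pushforward => //; exact: inth.
have OK : Omega `<=` K by exact: subset_closure.
have bK : bd `<=` K by exact: boundary_subset.
have fO : (\int[f]_(x in Omega) (h x)%:E =
    \int[gamma]_(z in p @^-1` Omega) (h (p z))%:E)%E.
  rewrite -push//; have [P PE] := pushforward_measure gamma mp.
  rewrite -PE; apply: eq_measure_integral => A mA AO.
  by rewrite PE -[in RHS](setIidl AO); apply/esym; exact: req.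
have intK2 : gamma.-integrable K2 (fun z => (h (p z))%:E).
  apply: (@bounded_continuous_integrable _ _ _ _ (fun z => h (p z)) M) => //.
  by move=> z /pK /hM.
have split : (\int[gamma]_(z in K2) (h (p z))%:E =
    \int[gamma]_(z in p @^-1` Omega) (h (p z))%:E +
    \int[gamma]_(z in p @^-1` bd) (h (p z))%:E)%E.
  rewrite -integral_setU; first last.
  - rewrite disj_set2E; apply/eqP/seteqP; split=> // z [/= Oz].
    by rewrite boundaryE// => -[].
  - rewrite -preimage_setU -closure_split//.
    exact: (measurable_int _ (inth _ mK _)).
  - exact: mpre.
  - exact: mpre.
  rewrite -preimage_setU -closure_split//.
  (* The preimage of [K] under [p] may exceed [K2], but only by a [gamma]-null set. *)
  pose N : set (borel (E * E)%type) := ~` K2.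
  rewrite [RHS](@negligible_integral _ (borel (E * E)%type) R gamma (p @^-1` K) N)//.
  - congr (integral _ _ _); apply/seteqP; split=> z /=.
      by move=> Kz; split; [exact: pK|move=> nKz; exact: nKz].
    by case=> _ /contrapT.
  - exact: measurableC.
  - exact: mpre.
  - exact: inth.
rewrite push// EFinB /Rintegral !fineK; first last.
- exact: integrable_fin_num.
- by rewrite fO; apply: integrable_fin_num => //; [exact: mpre|exact: inth].
rewrite split fO addeAC subee ?add0e//.
by apply: integrable_fin_num => //; [exact: mpre|exact: inth].
Qed.

(** Finite measures that agree on the open sets, which are stable under intersection, are equal. For
    [U] open, write [U] intersected with [Omega] as [phi > 0]: the functions [min 1 (k * phi)] are
    admissible tests, as [phi] vanishes on the boundary, and they increase to its indicator. *)
Lemma restriction_eq_of_integrals : concentrated_on f Omega ->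
  (forall u : E -> R, continuous u -> (forall x, 0 <= u x <= 1) ->
    (forall x, bd x -> u x = 0) ->
    (\int[gamma]_(z in K2) (u (p z))%:E = \int[f]_(x in Omega) (u x)%:E)%E) ->
  restriction_eq Omega
    (pushforward gamma (p : borel (E * E)%type -> borel E)) f.
Proof.
move=> fO uP.
have [P PE] := pushforward_measure gamma mp.
have fI (A : set (borel E)) : measurable A -> f (A `&` Omega) = f A.
  move=> mA; rewrite [RHS](_ : _ = f ((A `&` Omega) `|` (A `&` ~` Omega))); last first.
    by rewrite -setIUr setUv setIT.
  have mAO := measurableI _ _ mA mOmega.
  have mAC := measurableI _ _ mA (measurableC mOmega).
  rewrite measureU//; last by rewrite setIACA setICr setI0.
  rewrite -[LHS]adde0; congr (_ + _)%E; apply/esym.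
  apply/eqP; rewrite eq_le measure_ge0 andbT -fO.
  apply: (le_measure f (mem_set mAC) (mem_set (measurableC mOmega))).
  exact: subIsetr.
move=> A mA; rewrite -PE -[LHS]/(mrestr P mOmega A).
apply: (@measure_unique _ R (borel E) (@open E) (fun=> setT) erefl _ _ _
  (mrestr P mOmega) f) => //.
- by move=> U V oU oV; exact: openI.
- by move=> _; exact: openT.
- by apply/seteqP; split=> // x _; exists 0%N.
- move=> U oU.
  have oUO : open (U `&` Omega) by apply: openI => //; case: domOmega.
  have [phi [cphi phi0 UE]] := open_cozero_set oUO.
  transitivity (f (U `&` Omega)); last exact: fI (open_borel oU).
  transitivity (gamma (p @^-1` (U `&` Omega))).
    have m1E : mrestr P mOmega U = gamma (p @^-1` (U `&` Omega)) by rewrite /mrestr PE.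
    exact: m1E.
  have mUO := open_borel oUO.
  have e1 : gamma (p @^-1` (U `&` Omega)) = gamma ([set z | 0 < phi (p z)] `&` K2).
    have mC : measurable (~` K2 : set (borel (E * E)%type)) by exact: measurableC.
    have mpU : measurable (p @^-1` (U `&` Omega) : set (borel (E * E)%type)).
      exact: mpre.
    rewrite -[RHS]adde0 -[in LHS](setIT (p @^-1` _)) -(setUv K2) setIUr.
    rewrite measureU//.
    + congr (_ + _)%E; first by rewrite UE.
      apply/eqP; rewrite eq_le measure_ge0 andbT -gammaK.
      apply: (le_measure gamma (mem_set (measurableI _ _ mpU mC)) (mem_set mC)).
      exact: subIsetr.
    + exact: measurableI.
    + exact: measurableI.
    + by rewrite setIACA setICr setI0.
  have e2 : f (U `&` Omega) = f ([set x | 0 < phi x] `&` Omega).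
    by rewrite -UE -setIA setIid.
  have cphip : continuous (fun z => phi (p z)).
    by move=> z; apply: continuous_comp; [exact: p_cont|exact: cphi].
  have h1 := @integral_cozero_cvg _ gamma K2 (fun z => phi (p z)) mK2 cphip
    (fun=> phi0 _).
  have h2 := @integral_cozero_cvg _ f Omega phi mOmega cphi phi0.
  have eqh : (fun k : nat => (\int[gamma]_(z in K2) (Num.min 1 (k%:R * phi (p z)))%:E)%E) =
     (fun k : nat => (\int[f]_(x in Omega) (Num.min 1 (k%:R * phi x))%:E)%E).
    apply/funext => k; apply: (uP (fun x => Num.min 1 (k%:R * phi x))) => [x|x|x bdx].
    - by apply: cont_min; [exact: cont_cst|apply: cont_mul => //; exact: cont_cst].
    - by rewrite le_min ler01 mulr_ge0//= ge_min lexx.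
    - have -> : phi x = 0.
        apply/eqP; rewrite eq_le phi0 andbT leNgt; apply/negP => px.
        have : (U `&` Omega) x by rewrite UE.
        by move: bdx; rewrite boundaryE// => -[_ nO] [_ /nO].
      by rewrite mulr0 min_r.
  move: h1; rewrite eqh => h1.
  transitivity (gamma ([set z | 0 < phi (p z)] `&` K2)); first exact: e1.
  transitivity (f ([set x | 0 < phi x] `&` Omega)); last exact: esym e2.
  exact: (cvg_unique _ h1 h2).
- have finP : (mrestr P mOmega setT < +oo)%E.
    rewrite /mrestr PE /pushforward ltey_eq fin_num_measure//.
    by apply: mpre; apply: measurableI.
  by move=> _; exact: finP.
Qed.

End marginal.
End transport_integrals.

(** * Duality *)

Section duality.
Variables (R : realType) (d : nat) (Omega : set 'rV[R]_d).
Hypothesis domOmega : bounded_domain Omega.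
Local Notation E := 'rV[R]_d.
Local Notation K := (closure Omega).
Local Notation K2 := (closure Omega `*` closure Omega).
Local Notation bd := (boundary Omega).
Variables fp fm : {finite_measure set (borel E) -> \bar R}.
Hypothesis fp_Omega : concentrated_on fp Omega.
Hypothesis fm_Omega : concentrated_on fm Omega.
Variables (g1 g2 G1 G2 : E -> R) (M1 M2 : R).
Hypothesis cG1 : continuous G1.
Hypothesis cG2 : continuous G2.
Hypothesis G1M : forall x, `|G1 x| <= M1.
Hypothesis G2M : forall x, `|G2 x| <= M2.
Hypothesis G1E : forall x, bd x -> G1 x = g1 x.
Hypothesis G2E : forall x, bd x -> G2 x = g2 x.

Let cfst : continuous (fst : E * E -> E). Proof. by move=> z; exact: cvg_fst. Qed.
Let csnd : continuous (snd : E * E -> E). Proof. by move=> z; exact: cvg_snd. Qed.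

Let compactK2 : compact K2.
Proof. by apply: compact_setX; exact: compact_domain. Qed.

Let closedK2 : closed K2. Proof. exact: closed_K2. Qed.

Let mK2 : measurable (K2 : set (borel (E * E)%type)).
Proof. exact: closed_borel. Qed.

Let mOmega : measurable (Omega : set (borel E)).
Proof. by apply: open_borel; case: domOmega. Qed.

Let OK : Omega `<=` K. Proof. exact: subset_closure. Qed.

Let bdK : bd `<=` K. Proof. exact: boundary_subset. Qed.

Let comp_fst (h : E -> R) : continuous h -> continuous (fun z : E * E => h z.1).
Proof. by move=> ch z; apply: continuous_comp; [exact: cfst|exact: ch]. Qed.

Let comp_snd (h : E -> R) : continuous h -> continuous (fun z : E * E => h z.2).
Proof. by move=> ch z; apply: continuous_comp; [exact: csnd|exact: ch]. Qed.

Let intK2 (gamma : {finite_measure set (borel (E * E)%type) -> \bar R})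
  (h : E * E -> R) : continuous h -> gamma.-integrable K2 (EFin \o h).
Proof.
move=> ch.
have [B hB] := continuous_compact_bound compactK2 (continuous_subspaceT ch).
exact: bounded_continuous_integrable hB.
Qed.

Let intO (f : {finite_measure set (borel E) -> \bar R}) (h : E -> R) :
  continuous h -> f.-integrable Omega (EFin \o h).
Proof.
move=> ch.
have [B hB] := continuous_compact_bound (compact_domain domOmega)
  (continuous_subspaceT ch).
by apply: (@bounded_continuous_integrable _ _ _ _ h B) => // x /OK /hB.
Qed.

Definition reduced_cost (z : E * E) : R :=
  eucl_dist z.1 z.2 + G2 z.2 - G1 z.1.

Let cdist : continuous (fun z : E * E => eucl_dist z.1 z.2).
Proof. exact: (continuous_eucl_dist cfst csnd). Qed.

Let ccost : continuous reduced_cost.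
Proof.
apply: cont_sub; last exact: comp_fst.
by apply: cont_add; [exact: cdist|exact: comp_snd].
Qed.

(** What remains, independently of the plan, when both boundary integrals of the cost are turned
    into integrals over [K2] by [marginal_integral]. *)
Definition cost_shift : R :=
  \int[fp]_(x in Omega) G1 x - \int[fm]_(x in Omega) G2 x.

Let fstK z : K2 z -> K z.1. Proof. by case. Qed.
Let sndK z : K2 z -> K z.2. Proof. by case. Qed.

Let marg1 gamma (h : E -> R) : Pib Omega fp fm gamma -> continuous h ->
  (\int[marginal1 gamma]_(x in bd) (h x)%:E =
   (\int[gamma]_(z in K2) h z.1 - \int[fp]_(x in Omega) h x)%:E)%E.
Proof.
move=> [gK r1 _] ch.
have [B hB] := continuous_compact_bound (compact_domain domOmega)
  (continuous_subspaceT ch).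
exact: (@marginal_integral R d Omega domOmega gamma fp fst gK cfst fstK h B r1 ch hB).
Qed.

Let marg2 gamma (h : E -> R) : Pib Omega fp fm gamma -> continuous h ->
  (\int[marginal2 gamma]_(x in bd) (h x)%:E =
   (\int[gamma]_(z in K2) h z.2 - \int[fm]_(x in Omega) h x)%:E)%E.
Proof.
move=> [gK _ r2] ch.
have [B hB] := continuous_compact_bound (compact_domain domOmega)
  (continuous_subspaceT ch).
exact: (@marginal_integral R d Omega domOmega gamma fm snd gK csnd sndK h B r2 ch hB).
Qed.

Let eq_marg (gamma : {finite_measure set (borel (E * E)%type) -> \bar R})
    (p : borel (E * E)%type -> borel E) (h k : E -> R) :
  measurable_fun setT p -> (forall x, bd x -> h x = k x) ->
  (\int[pushforward gamma p]_(x in bd) (h x)%:E =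
   \int[pushforward gamma p]_(x in bd) (k x)%:E)%E.
Proof.
move=> mp hk; have [P PE] := pushforward_measure gamma mp.
by rewrite -PE; apply: eq_integral => x /set_mem bx; rewrite hk.
Qed.

Let marg_ge0 (gamma : {finite_measure set (borel (E * E)%type) -> \bar R})
    (p : borel (E * E)%type -> borel E) (h : E -> R) :
  measurable_fun setT p -> (forall x, bd x -> 0 <= h x) ->
  (0 <= \int[pushforward gamma p]_(x in bd) (h x)%:E)%E.
Proof.
move=> mp h0; have [P PE] := pushforward_measure gamma mp.
by rewrite -PE; apply: integral_ge0 => x bx; rewrite lee_fin h0.
Qed.

Let mfst : measurable_fun setT (fst : borel (E * E)%type -> borel E).
Proof. exact: (continuous_borel cfst). Qed.

Let msnd : measurable_fun setT (snd : borel (E * E)%type -> borel E).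
Proof. exact: (continuous_borel csnd). Qed.

Lemma primal_costE gamma : Pib Omega fp fm gamma ->
  primal_cost Omega g1 g2 gamma =
  (\int[gamma]_(z in K2) reduced_cost z + cost_shift)%:E.
Proof.
move=> gP; rewrite /primal_cost.
have -> : (\int[marginal2 gamma]_(y in bd) (g2 y)%:E =
    \int[marginal2 gamma]_(y in bd) (G2 y)%:E)%E.
  by apply: eq_marg => [|y ybd]; [exact: msnd|rewrite G2E].
have -> : (\int[marginal1 gamma]_(y in bd) (g1 y)%:E =
    \int[marginal1 gamma]_(y in bd) (G1 y)%:E)%E.
  by apply: eq_marg => [|y ybd]; [exact: mfst|rewrite G1E].
rewrite marg2// marg1//.
have -> : (\int[gamma]_(z in K2) (eucl_dist z.1 z.2)%:E)%E =
    (\int[gamma]_(z in K2) eucl_dist z.1 z.2)%:E.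
  by rewrite /Rintegral fineK//; apply: integrable_fin_num => //; exact: intK2 cdist.
rewrite -EFinD; congr EFin.
rewrite /reduced_cost RintegralB//; first last.
- exact: intK2 (comp_fst cG1).
- exact: intK2 (cont_add cdist (comp_snd cG2)).
rewrite RintegralD//; first last.
- exact: intK2 (comp_snd cG2).
- exact: intK2 cdist.
by rewrite /cost_shift; ring.
Qed.

Lemma dual_valueE (phi Phi : E -> R) : continuous Phi ->
  (forall x, K x -> Phi x = phi x) ->
  dual_value Omega fp fm phi =
  (\int[fp]_(x in Omega) Phi x - \int[fm]_(x in Omega) Phi x)%:E.
Proof.
move=> cPhi PhiE; rewrite /dual_value EFinB /Rintegral !fineK.
- by congr (_ - _)%E; apply: eq_integral => x /set_mem /OK Kx; rewrite PhiE.
- by apply: integrable_fin_num => //; exact: intO.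
- by apply: integrable_fin_num => //; exact: intO.
Qed.

Lemma weak_duality phi gamma : dual_admissible Omega g1 g2 phi ->
  Pib Omega fp fm gamma ->
  (dual_value Omega fp fm phi <= primal_cost Omega g1 g2 gamma)%E.
Proof.
move=> [phil phib] gP.
have [Phi [M [cPhi _ PhiE]]] :=
  compact_extension (compact_domain domOmega) (Lip1_continuous phil).
rewrite (dual_valueE cPhi PhiE) primal_costE// lee_fin.
have c1 : continuous (fun x => Phi x - G1 x) by exact: cont_sub.
have c2 : continuous (fun x => G2 x - Phi x) by exact: cont_sub.
(* The difference is the integral of [Phi - G1] over the boundary against the first marginal, where
   the dual constraint gives the sign; [h2] is the analogue for the second marginal. *)
have h1 : 0 <= \int[gamma]_(z in K2) (Phi z.1 - G1 z.1) -
    \int[fp]_(x in Omega) (Phi x - G1 x).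
  rewrite -lee_fin -(marg1 gP c1); apply: (marg_ge0 _ mfst) => x bx.
  by rewrite subr_ge0 G1E// PhiE; [case/andP: (phib _ bx)|exact: bdK].
have h2 : 0 <= \int[gamma]_(z in K2) (G2 z.2 - Phi z.2) -
    \int[fm]_(x in Omega) (G2 x - Phi x).
  rewrite -lee_fin -(marg2 gP c2); apply: (marg_ge0 _ msnd) => x bx.
  by rewrite subr_ge0 G2E// PhiE; [case/andP: (phib _ bx)|exact: bdK].
have h3 : \int[gamma]_(z in K2) ((Phi z.1 - G1 z.1) + (G2 z.2 - Phi z.2)) <=
    \int[gamma]_(z in K2) reduced_cost z.
  apply: le_Rintegral => //.
  - exact: intK2 (cont_add (comp_fst c1) (comp_snd c2)).
  - exact: intK2 ccost.
  - move=> z [K1 K2z]; rewrite /reduced_cost.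
    have := phil z.1 z.2 (mem_set K1) (mem_set K2z).
    rewrite -!PhiE// => /(le_trans (ler_norm _)); lra.
move: h3; rewrite RintegralD//; first last.
- exact: intK2 (comp_snd c2).
- exact: intK2 (comp_fst c1).
move: h1 h2; rewrite (RintegralB mOmega (intO fp cPhi) (intO fp cG1)).
rewrite (RintegralB mOmega (intO fm cG2) (intO fm cPhi)) /cost_shift.
lra.
Qed.

(** Riesz representation on [K2]. Test functions vanishing on the boundary determine the marginals
    inside [Omega] and leave them free on the boundary, exactly as admissibility demands. *)
Lemma plan_of_functional (L : (E * E -> R) -> R) :
  (forall f g : E * E -> R, continuous f -> continuous g ->
    L (fun z => f z + g z) = L f + L g) ->
  (forall (a : R) (f : E * E -> R), continuous f ->
    L (fun z => a * f z) = a * L f) ->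
  (forall f : E * E -> R, continuous f -> (forall z, K2 z -> 0 <= f z) ->
    0 <= L f) ->
  (forall u : E -> R, continuous u -> (forall x, bd x -> u x = 0) ->
    L (fun z => u z.1) = \int[fp]_(x in Omega) u x) ->
  (forall u : E -> R, continuous u -> (forall x, bd x -> u x = 0) ->
    L (fun z => u z.2) = \int[fm]_(x in Omega) u x) ->
  exists2 gamma, Pib Omega fp fm gamma &
    primal_cost Omega g1 g2 gamma = (L reduced_cost + cost_shift)%:E.
Proof.
move=> LD LZ L0 Lfst Lsnd.
have [gamma [gK gL]] := riesz_compact compactK2 closedK2
  (@open_cozero_set R (E * E)%type) LD LZ L0.
have r1 : restriction_eq Omega
    (pushforward gamma (fst : borel (E * E)%type -> borel E)) fp.
  apply: (restriction_eq_of_integrals domOmega gK cfst fp_Omega) => u cu _ u0.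
  rewrite gL; last exact: comp_fst.
  by rewrite Lfst// /Rintegral fineK//; apply: integrable_fin_num => //; exact: intO.
have r2 : restriction_eq Omega
    (pushforward gamma (snd : borel (E * E)%type -> borel E)) fm.
  apply: (restriction_eq_of_integrals domOmega gK csnd fm_Omega) => u cu _ u0.
  rewrite gL; last exact: comp_snd.
  by rewrite Lsnd// /Rintegral fineK//; apply: integrable_fin_num => //; exact: intO.
have gP : Pib Omega fp fm gamma by split; [exact: gK|exact: r1|exact: r2].
exists gamma => //; rewrite primal_costE// /Rintegral gL//.
Qed.

(* The plan is the sum of the product of [fp] with the Dirac mass at [y1], of the
   product of the Dirac mass at [x1] with [fm], and of [n] times the Dirac mass
   at [(x1, y1)]. *)
Lemma explicit_plan x1 y1 : bd x1 -> bd y1 ->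
  exists c : R, forall n : nat, exists2 gamma, Pib Omega fp fm gamma &
    primal_cost Omega g1 g2 gamma = (c + n%:R * reduced_cost (x1, y1))%:E.
Proof.
move=> bx by1.
pose L0 (h : E * E -> R) := \int[fp]_(x in Omega) h (x, y1) +
  \int[fm]_(y in Omega) h (x1, y).
have cl (h : E * E -> R) : continuous h -> continuous (fun x => h (x, y1)).
  move=> ch x; apply: (@continuous_comp _ _ _ (fun x : E => (x, y1)) h); last exact: ch.
  exact: (@cvg_pair _ _ _ (nbhs x) (nbhs x) (nbhs y1) _ _ _ id (fun=> y1)
    cvg_id (cvg_cst y1)).
have cr (h : E * E -> R) : continuous h -> continuous (fun y => h (x1, y)).
  move=> ch y; apply: (@continuous_comp _ _ _ (fun y : E => (x1, y)) h); last exact: ch.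
  exact: (@cvg_pair _ _ _ (nbhs y) (nbhs x1) (nbhs y) _ _ _ (fun=> x1) id
    (cvg_cst x1) cvg_id).
exists (L0 reduced_cost + cost_shift) => n.
have [|||||gamma gP gE] := @plan_of_functional (fun h => L0 h + n%:R * h (x1, y1)).
- move=> f g cf cg; rewrite /L0.
  rewrite (RintegralD mOmega (intO fp (cl _ cf)) (intO fp (cl _ cg))).
  rewrite (RintegralD mOmega (intO fm (cr _ cf)) (intO fm (cr _ cg))); ring.
- move=> a f cf; rewrite /L0.
  rewrite (RintegralZl a mOmega (intO fp (cl _ cf))).
  rewrite (RintegralZl a mOmega (intO fm (cr _ cf))); ring.
- move=> f cf f0; rewrite /L0 !addr_ge0//.
  + by apply: Rintegral_ge0 => x Ox; apply: f0; split; [exact: OK|exact: bdK].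
  + by apply: Rintegral_ge0 => x Ox; apply: f0; split; [exact: bdK|exact: OK].
  + by rewrite mulr_ge0// f0//; split; exact: bdK.
- move=> u cu u0; rewrite /L0/= u0// mulr0 addr0.
  by rewrite Rintegral_cst// mul0r addr0.
- move=> u cu u0; rewrite /L0/= u0// mulr0 addr0.
  by rewrite Rintegral_cst// mul0r add0r.
exists gamma => //; apply: (etrans gE); congr EFin; ring.
Qed.

Let mass : R := fine (fp Omega) + fine (fm Omega).

(* With [phi = u + G1] and [psi = G2 - v], the hypothesis reads
   [phi x - psi y <= |x - y| + s]. The witness is the inf-convolution with the
   distance of the function equal to [g2] on the boundary and to [psi + s]
   elsewhere: it is 1-Lipschitz and lies between [phi - s] and [psi + s]. *)
Lemma relaxed_dual (u v : E -> R) (s : R) :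
  boundary_compatible Omega g1 g2 -> Omega !=set0 ->
  continuous u -> continuous v ->
  (forall x, bd x -> u x = 0) -> (forall x, bd x -> v x = 0) -> 0 <= s ->
  (forall x y, K x -> K y -> u x + v y <= reduced_cost (x, y) + s) ->
  exists2 chi, dual_admissible Omega g1 g2 chi &
    ((\int[fp]_(x in Omega) u x + \int[fm]_(x in Omega) v x
      - s * mass + cost_shift)%:E <= dual_value Omega fp fm chi)%E.
Proof.
move=> compat [x0 Ox0] cu cv u0 v0 s0 uv; rewrite /reduced_cost/= in uv.
pose f y := if y \in bd then g2 y else G2 y - v y + s.
have f_ge y : G2 y - v y <= f y.
  rewrite /f; case: ifPn => [/set_mem yb|_]; last by rewrite lerDl.
  by rewrite v0// subr0 G2E.
have f_le y : f y <= G2 y - v y + s.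
  rewrite /f; case: ifPn => [/set_mem yb|//].
  by rewrite v0// subr0 G2E// lerDl.
have [B vB] := continuous_compact_bound (compact_domain domOmega)
  (continuous_subspaceT cv).
have K0 : K !=set0 by exists x0; exact: OK.
have fB y : K y -> - (M2 + B) <= f y.
  move=> Ky; apply: le_trans (f_ge y).
  have := G2M y; have := vB y Ky; rewrite !ler_norml => /andP[_ ?] /andP[? _]; lra.
pose chi := infconv K f.
have chil : Lip1 K chi by move=> x y _ _; exact: infconv_lip fB x y.
have chi_le x : K x -> chi x <= f x.
  by move=> Kx; have := infconv_le fB x Kx; rewrite eucl_distxx addr0.
(* For the lower bound [g1 x <= chi x], a competitor [y] on the boundary is handled by the
   compatibility condition, any other by the relaxed constraint at [(x, y)], where [u x = 0]. *)
have chiP : dual_admissible Omega g1 g2 chi.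
  split=> // x bx; have Kx := bdK bx; apply/andP; split.
    apply: le_infconv => // y Ky; rewrite /f; case: ifPn => [/set_mem yb|_].
      by have := compat x y bx yb; lra.
    by have := uv x y Kx Ky; rewrite u0// G1E//; lra.
  by apply: (le_trans (chi_le _ Kx)); rewrite /f mem_set.
exists chi => //.
have [Chi [M [cChi _ ChiE]]] :=
  compact_extension (compact_domain domOmega) (Lip1_continuous chil).
rewrite (dual_valueE cChi ChiE) lee_fin.
have cs : continuous (fun _ : E => s) by exact: cont_cst.
have h1 : \int[fp]_(x in Omega) (u x + G1 x - s) <= \int[fp]_(x in Omega) Chi x.
  apply: le_Rintegral => //; [exact: intO (cont_sub (cont_add cu cG1) cs)|exact: intO|].
  move=> x Ox; rewrite ChiE; last exact: OK.
  apply: le_infconv => // y Ky.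
  have := uv x y (OK Ox) Ky; have := f_ge y; lra.
have h2 : \int[fm]_(x in Omega) Chi x <= \int[fm]_(x in Omega) (G2 x - v x + s).
  apply: le_Rintegral => //; [exact: intO|exact: intO (cont_add (cont_sub cG2 cv) cs)|].
  move=> x Ox; rewrite ChiE; last exact: OK.
  by apply: (le_trans (chi_le _ (OK Ox))); exact: f_le.
move: h1 h2.
rewrite (RintegralB mOmega (intO fp (cont_add cu cG1)) (intO fp cs)).
rewrite (RintegralD mOmega (intO fp cu) (intO fp cG1)).
rewrite (RintegralD mOmega (intO fm (cont_sub cG2 cv)) (intO fm cs)).
rewrite (RintegralB mOmega (intO fm cG2) (intO fm cv)).
rewrite !Rintegral_cst// /mass /cost_shift; lra.
Qed.

(** * Strong duality and existence of an optimal plan *)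

Section strong.
Hypothesis compat : boundary_compatible Omega g1 g2.
Hypothesis bd0 : bd !=set0.

Let Omega0 : Omega !=set0. Proof. by case: domOmega. Qed.

(** Above, weak duality against one explicit plan; below, [relaxed_dual] with [u = v = 0] and [s] a
    bound for the reduced cost. *)
Lemma dual_sup_fin_num : dual_sup Omega fp fm g1 g2 \is a fin_num.
Proof.
have [x0 bx0] := bd0.
have [c cP] := explicit_plan bx0 bx0; have [gamma gP gE] := cP 0%N.
have c0 : continuous (fun _ : E => 0 : R) by exact: cont_cst.
have [B cB] := continuous_compact_bound compactK2 (continuous_subspaceT ccost).
have B0 : 0 <= B by rewrite (le_trans _ (cB (x0, x0) _))//; split; exact: bdK.
have [//|//|x y Kx Ky|chi chiP chiE] := relaxed_dual compat Omega0 c0 c0 _ _ B0.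
  have := cB (x, y) (conj Kx Ky); rewrite ler_norml => /andP[]; lra.
rewrite fin_numElt; apply/andP; split.
  apply: (lt_le_trans (ltNyr _) (le_trans chiE _)).
  by apply: ereal_sup_ubound; exists chi.
apply: (@le_lt_trans _ _ (primal_cost Omega g1 g2 gamma)); last by rewrite gE ltry.
by apply: ge_ereal_sup => _ [phi phiP <-]; exact: weak_duality.
Qed.

Let D : R := fine (dual_sup Omega fp fm g1 g2) - cost_shift.

Let intN (f : {finite_measure set (borel E) -> \bar R}) (a : R) (u : E -> R) :
  continuous u -> \int[f]_(x in Omega) (a * u x) = a * \int[f]_(x in Omega) u x.
Proof. by move=> cu; exact: (RintegralZl a mOmega (intO f cu)). Qed.

(** Every majorant of the zero function has a nonnegative price, which is what keeps [p] finite. For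
    [t > 0], divide by [t]: then [- u / t] and [- v / t] satisfy the dual constraint with error
    [s / t], and [relaxed_dual] compares them with the dual supremum. *)
Let nonneg_value (u v : E -> R) (s t : R) : continuous u -> continuous v ->
  (forall x, bd x -> u x = 0) -> (forall x, bd x -> v x = 0) ->
  0 <= s -> 0 <= t ->
  (forall x y, K x -> K y -> 0 <= u x + v y + s + t * reduced_cost (x, y)) ->
  0 <= \int[fp]_(x in Omega) u x + \int[fm]_(x in Omega) v x + s * mass + t * D.
Proof.
move=> cu cv u0 v0 s0; rewrite le_eqVlt => /predU1P[<-|t0] h.
  (* For [t = 0], placing one of the two points on the boundary, where [u] and [v] vanish, gives
     [u >= - s] and [v >= - s] separately. *)
  have [z0 bz0] := bd0; have Kz0 := bdK bz0.
  have cs : continuous (fun _ : E => - s) by exact: cont_cst.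
  have hu : \int[fp]_(x in Omega) (- s) <= \int[fp]_(x in Omega) u x.
    apply: le_Rintegral => //; [exact: intO cs|exact: intO|move=> x Ox].
    by have := h x z0 (OK Ox) Kz0; rewrite v0//; lra.
  have hv : \int[fm]_(x in Omega) (- s) <= \int[fm]_(x in Omega) v x.
    apply: le_Rintegral => //; [exact: intO cs|exact: intO|move=> x Ox].
    by have := h z0 x Kz0 (OK Ox); rewrite u0//; lra.
  by move: hu hv; rewrite !Rintegral_cst// /mass; lra.
have t1 : 0 <= t^-1 by rewrite invr_ge0 ltW.
have cN (w : E -> R) : continuous w -> continuous (fun x => - t^-1 * w x).
  by move=> cw; apply: cont_mul => //; exact: cont_cst.
have [x bx|x bx||x y Kx Ky|chi chiP chiE] :=
    @relaxed_dual (fun x => - t^-1 * u x) (fun x => - t^-1 * v x) (t^-1 * s)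
      compat Omega0 (cN _ cu) (cN _ cv).
- by rewrite u0// mulr0.
- by rewrite v0// mulr0.
- exact: mulr_ge0.
- rewrite -subr_ge0.
  have -> : reduced_cost (x, y) + t^-1 * s - (- t^-1 * u x + - t^-1 * v y) =
    t^-1 * (u x + v y + s + t * reduced_cost (x, y)).
    by field; rewrite gt_eqF.
  by apply: mulr_ge0 => //; exact: h.
have : (dual_value Omega fp fm chi <= (fine (dual_sup Omega fp fm g1 g2))%:E)%E.
  by rewrite fineK ?dual_sup_fin_num//; apply: ereal_sup_ubound; exists chi.
move=> /(le_trans chiE); rewrite lee_fin !intN// -subr_ge0 => h2.
have := mulr_ge0 (ltW t0) h2.
set a := \int[fp]_(x in Omega) u x; set b := \int[fm]_(x in Omega) v x.
set q := fine (dual_sup _ _ _ _ _).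
have -> : t * (q - (- t^-1 * a + - t^-1 * b - t^-1 * s * mass + cost_shift)) =
  a + b + s * mass + t * (q - cost_shift) by field; rewrite gt_eqF.
by [].
Qed.

(** The prices whose infimum is the sublinear functional [p]. Charging [mass] for the constant 1
    will bound the mass of the plan, and charging [D] for the reduced cost will bound its cost. *)
Definition majorant_values (h : E * E -> R) : set R :=
  [set r | exists (u v : E -> R) (s t : R),
    [/\ continuous u /\ continuous v,
      (forall x, bd x -> u x = 0) /\ (forall x, bd x -> v x = 0),
      0 <= s /\ 0 <= t,
      forall x y, K x -> K y -> h (x, y) <= u x + v y + s + t * reduced_cost (x, y) &
      r = \int[fp]_(x in Omega) u x + \int[fm]_(x in Omega) v x + s * mass + t * D]].

Let W := majorant_values.

Let W_lb (h : E * E -> R) : continuous h -> exists c, forall r, W h r -> c <= r.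
Proof.
move=> ch.
have [B hB] := continuous_compact_bound compactK2 (continuous_subspaceT ch).
have B0 : 0 <= B.
  have [z bz] := bd0.
  by rewrite (le_trans _ (hB (z, z) _))//; split; exact: bdK.
exists (- (B * mass)) => _ [u [v [s [t [[cu cv] [u0 v0] [s0 t0] le_h ->]]]]].
(* As [h >= - B] on [K2], raising [s] by [B] turns a majorant of [h] into one of the zero function,
   at the extra price [B * mass]. *)
have := @nonneg_value u v (s + B) t cu cv u0 v0 (addr_ge0 s0 B0) t0 _.
have hh x y : K x -> K y -> 0 <= u x + v y + (s + B) + t * reduced_cost (x, y).
  move=> Kx Ky; have := le_h _ _ Kx Ky.
  by have := hB (x, y) (conj Kx Ky); rewrite ler_norml => /andP[]; lra.
by move=> /(_ hh); lra.
Qed.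

Let c0 : continuous (fun _ : E => 0 : R). Proof. exact: cont_cst. Qed.

Let int0 (f : {finite_measure set (borel E) -> \bar R}) :
  \int[f]_(x in Omega) (0 : R) = 0.
Proof. by rewrite Rintegral_cst// mul0r. Qed.

Let W_neq0 (h : E * E -> R) : continuous h -> W h !=set0.
Proof.
move=> ch.
have [B hB] := continuous_compact_bound compactK2 (continuous_subspaceT ch).
have B0 : 0 <= B.
  have [z bz] := bd0.
  by rewrite (le_trans _ (hB (z, z) _))//; split; exact: bdK.
eexists; exists (fun=> 0), (fun=> 0), B, 0; split=> // x y Kx Ky.
by have := hB (x, y) (conj Kx Ky); rewrite ler_norml => /andP[]; lra.
Qed.

Let WD (h k : E * E -> R) (r q : R) : W h r -> W k q ->
  W (fun z => h z + k z) (r + q).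
Proof.
move=> [u [v [s [t [[cu cv] [u0 v0] [s0 t0] le_h ->]]]]].
move=> [u' [v' [s' [t' [[cu' cv'] [u0' v0'] [s0' t0'] le_k ->]]]]].
exists (fun x => u x + u' x), (fun x => v x + v' x), (s + s'), (t + t'); split.
- by split; exact: cont_add.
- by split=> x bx; rewrite ?u0 ?u0' ?v0 ?v0'// addr0.
- by split; exact: addr_ge0.
- by move=> x y Kx Ky; have := le_h _ _ Kx Ky; have := le_k _ _ Kx Ky; lra.
- rewrite (RintegralD mOmega (intO fp cu) (intO fp cu')).
  by rewrite (RintegralD mOmega (intO fm cv) (intO fm cv')); ring.
Qed.

Let WZ (a : R) (h : E * E -> R) (r : R) : 0 <= a -> W h r ->
  W (fun z => a * h z) (a * r).
Proof.
move=> a0 [u [v [s [t [[cu cv] [u0 v0] [s0 t0] le_h ->]]]]].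
exists (fun x => a * u x), (fun x => a * v x), (a * s), (a * t); split.
- by split; apply: cont_mul => //; exact: cont_cst.
- by split=> x bx; rewrite ?u0 ?v0// mulr0.
- by split; exact: mulr_ge0.
- move=> x y Kx Ky; have := ler_wpM2l a0 (le_h _ _ Kx Ky); lra.
- by rewrite !intN//; ring.
Qed.

Let p (h : E * E -> R) : R := inf (W h).

Let p_le (h : E * E -> R) (r : R) : continuous h -> W h r -> p h <= r.
Proof.
move=> ch Wr; apply: ge_inf => //.
by have [c cP] := W_lb ch; exists c => q /cP.
Qed.

Let p_sublinear :
  sublinear_on [set h : E * E -> R^o | continuous h] p.
Proof.
split=> [h k /= ch ck|a h a0 /= ch].
  have chk : continuous (fun z => h z + k z) by exact: cont_add.
  rewrite -lerBlDr; apply: lb_le_inf; first exact: W_neq0.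
  move=> r Wr; rewrite lerBlDr -lerBlDl; apply: lb_le_inf; first exact: W_neq0.
  move=> q Wq; rewrite lerBlDl.
  by apply: p_le; [exact: chk|exact: WD].
have cah : continuous (fun z => a * h z) by apply: cont_mul => //; exact: cont_cst.
move: a0; rewrite le_eqVlt => /predU1P[a0|a0].
  rewrite -a0 mul0r; apply: p_le; first by rewrite a0; exact: cah.
  have [r Wr] := W_neq0 ch.
  by have := @WZ 0 h r (lexx 0) Wr; rewrite mul0r.
rewrite mulrC -ler_pdivrMr//; apply: lb_le_inf; first exact: W_neq0.
move=> r Wr; rewrite ler_pdivrMr// mulrC.
by apply: p_le => //; apply: WZ => //; exact: ltW.
Qed.

(** A linear [L] below [p] is at most every price. Nonpositive functions have price 0, so [L] is
    positive. A function of one variable vanishing on the boundary is its own majorant, and so is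
    its opposite, so both inequalities hold and [L] has the right marginals. *)
Lemma optimal_plan : exists2 gamma, Pib Omega fp fm gamma &
  (primal_cost Omega g1 g2 gamma <= dual_sup Omega fp fm g1 g2)%E.
Proof.
have [||L [Lp LD LZ]] := linear_below_sublinear _ _ p_sublinear.
- by move=> h k ch ck; exact: cont_add.
- by move=> a h ch; apply: cont_mul => //; exact: cont_cst.
have LN (h : E * E -> R) : continuous h -> L (fun z => - h z) = - L h.
  move=> ch; rewrite -[RHS]mulN1r -LZ//; congr L; apply/funext => z.
  by rewrite -[RHS]/(-1 * h z) mulN1r.
have W0 (h : E * E -> R) : (forall x y, K x -> K y -> h (x, y) <= 0) -> W h 0.
  move=> h0; exists (fun=> 0), (fun=> 0), 0, 0; split=> //.
    by move=> x y Kx Ky; rewrite mul0r !addr0 h0.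
  by rewrite !int0 !mul0r !addr0.
have Wfst (u : E -> R) : continuous u -> (forall x, bd x -> u x = 0) ->
    W (fun z => u z.1) (\int[fp]_(x in Omega) u x).
  move=> cu u0; exists u, (fun=> 0), 0, 0; split=> //.
    by move=> x y Kx Ky; rewrite mul0r !addr0.
  by rewrite !int0 !mul0r !addr0.
have Wsnd (u : E -> R) : continuous u -> (forall x, bd x -> u x = 0) ->
    W (fun z => u z.2) (\int[fm]_(x in Omega) u x).
  move=> cu u0; exists (fun=> 0), u, 0, 0; split=> //.
    by move=> x y Kx Ky; rewrite mul0r !addr0 add0r.
  by rewrite !int0 !mul0r !addr0 add0r.
have cNf (w : E -> R) : continuous w -> continuous (fun x => -1 * w x).
  by move=> cw; apply: cont_mul => //; exact: cont_cst.
have zN (w : E -> R) : (forall x, bd x -> w x = 0) -> forall x, bd x -> -1 * w x = 0.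
  by move=> w0 x bx; rewrite w0// mulr0.
have LW (h : E * E -> R) (r : R) : continuous h -> W h r -> L h <= r.
  by move=> ch Wr; apply: (le_trans (Lp _ ch)); exact: p_le.
have [||f cf f0|u cu u0|u cu u0|gamma gP gE] := @plan_of_functional L.
- by move=> f g cf cg; exact: LD.
- by move=> a f cf; exact: LZ.
- rewrite -oppr_le0 -LN//; apply: LW.
    by move=> z; apply: cvgN; exact: cf.
  by apply: W0 => x y Kx Ky; rewrite oppr_le0; apply: f0.
- apply/eqP; rewrite eq_le; apply/andP; split.
    by apply: LW; [exact: comp_fst|exact: Wfst].
  rewrite -lerN2 -LN; last exact: comp_fst.
  have -> : (fun z : E * E => - u z.1) = (fun z => -1 * u z.1).
    by apply/funext => z; rewrite mulN1r.
  rewrite -[leRHS]mulN1r -intN//.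
  by apply: LW; [exact: (comp_fst (cNf _ cu))|exact: (Wfst _ (cNf _ cu) (zN _ u0))].
- apply/eqP; rewrite eq_le; apply/andP; split.
    by apply: LW; [exact: comp_snd|exact: Wsnd].
  rewrite -lerN2 -LN; last exact: comp_snd.
  have -> : (fun z : E * E => - u z.2) = (fun z => -1 * u z.2).
    by apply/funext => z; rewrite mulN1r.
  rewrite -[leRHS]mulN1r -intN//.
  by apply: LW; [exact: (comp_snd (cNf _ cu))|exact: (Wsnd _ (cNf _ cu) (zN _ u0))].
exists gamma => //; rewrite gE -(fineK dual_sup_fin_num) lee_fin -lerBrDr.
(* The reduced cost is its own majorant with [t = 1], at price [D]. *)
apply: LW => //; exists (fun=> 0), (fun=> 0), 0, 1; split=> //.
  by move=> x y _ _; rewrite mul1r !add0r.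
by rewrite !int0 mul0r !add0r mul1r.
Qed.

End strong.
End duality.

Theorem proposition2p2 (R : realType) (d : nat) (d_gt0 : (0 < d)%N)
    (Omega : set 'rV[R]_d) (domOmega : bounded_domain Omega)
    (fp fm : {finite_measure set (borel 'rV[R]_d) -> \bar R})
    (fp_Omega : concentrated_on fp Omega)
    (fm_Omega : concentrated_on fm Omega)
    (g1 g2 : 'rV[R]_d -> R)
    (g1_cont : {within boundary Omega, continuous g1})
    (g2_cont : {within boundary Omega, continuous g2}) :
  (boundary_compatible Omega g1 g2 ->
     (exists2 gamma : {finite_measure set (borel ('rV[R]_d * 'rV[R]_d)%type)
                         -> \bar R},
        Pib Omega fp fm gamma &
        primal_cost Omega g1 g2 gamma = primal_inf Omega fp fm g1 g2) /\
     primal_inf Omega fp fm g1 g2 = dual_sup Omega fp fm g1 g2) /\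
  (~ boundary_compatible Omega g1 g2 ->
     primal_inf Omega fp fm g1 g2 = -oo%E /\
     dual_sup Omega fp fm g1 g2 = -oo%E).
Proof.
have cbd := compact_boundary domOmega.
have [G1 [M1 [cG1 G1M G1E]]] := compact_extension cbd g1_cont.
have [G2 [M2 [cG2 G2M G2E]]] := compact_extension cbd g2_cont.
split=> [compat|ncompat].
  have bd0 := boundary_neq0 domOmega d_gt0.
  have [gamma gP le_gamma] :=
    optimal_plan domOmega fp_Omega fm_Omega cG1 cG2 G2M G1E G2E compat bd0.
  have inf_le : (primal_inf Omega fp fm g1 g2 <= primal_cost Omega g1 g2 gamma)%E.
    by apply: ereal_inf_lbound; exists gamma.
  have sup_le : (dual_sup Omega fp fm g1 g2 <= primal_inf Omega fp fm g1 g2)%E.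
    apply: ge_ereal_sup => _ [phi phiP <-].
    apply: le_ereal_inf_tmp => _ [pi piP <-].
    exact: (weak_duality domOmega cG1 cG2 G1E G2E).
  split.
    exists gamma => //; apply/eqP; rewrite eq_le inf_le andbT.
    exact: le_trans le_gamma sup_le.
  by apply/eqP; rewrite eq_le sup_le andbT (le_trans inf_le).
have [x1 [y1 [bx1 by1 lt_xy]]] : exists x y, [/\ boundary Omega x,
    boundary Omega y & eucl_dist x y < g1 x - g2 y].
  apply: contrapT => nex; apply: ncompat => x y bx bdy.
  by rewrite leNgt; apply/negP => xy; apply: nex; exists x, y.
split; last first.
  rewrite /dual_sup (_ : [set _ | _ in _] = set0) ?ereal_sup0//.
  (* An admissible [phi] would give [g1 x1 - g2 y1 <= phi x1 - phi y1], at most the distance,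
     against the choice of the pair; the supremum is over the empty set. *)
  apply/eqP/negPn/negP => /set0P[_ [phi [phil phib] _]].
  have /andP[h1 _] := phib _ bx1; have /andP[_ h2] := phib _ by1.
  have := phil x1 y1 (mem_set (boundary_subset bx1)) (mem_set (boundary_subset by1)).
  by move=> /(le_trans (ler_norm _)); lra.
have [c cP] := explicit_plan domOmega fp_Omega fm_Omega cG1 cG2 G1E G2E bx1 by1.
have neg : reduced_cost G1 G2 (x1, y1) < 0.
  by rewrite /reduced_cost/= G1E// G2E//; lra.
apply: eq_ninfty => A; set r := reduced_cost G1 G2 (x1, y1) in neg cP.
(* Since [r] is negative, [n] larger than this quotient makes the cost [c + n * r] smaller than
   [A]. *)
pose n := (Num.truncn ((c - A) / - r)).+1.
have [gamma gP gE] := cP n.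
apply: (@le_trans _ _ (primal_cost Omega g1 g2 gamma)).
  by apply: ereal_inf_lbound; exists gamma.
rewrite gE lee_fin.
have : (c - A) / - r < n%:R by exact: truncnS_gt.
by rewrite ltr_pdivrMr ?oppr_gt0//; lra.
Qed.
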